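(* Let $G$ be a cubic graph. Then: (i) $t(G)<\frac{|V(G)|}{4}$; (ii) if $G$ is simple (has no parallel edges), then $t(G)<\frac{|V(G)|}{6}$. Moreover, these bounds are asymptotically tight: there is a sequence of cubic graphs $G_n$ with $|V(G_n)|\to\infty$ and $t(G_n)/|V(G_n)|\to \frac14$, and a sequence of simple cubic graphs $G'_n$ with $|V(G'_n)|\to\infty$ and $t(G'_n)/|V(G'_n)|\to \frac16$.
   Context: Graphs are finite and loopless but may have parallel edges (and may have bridges). A cubic graph is one in which every vertex has degree $3$. For a cubic graph $G$ and $U\subseteq V(G)$, $G_U$ denotes the cubic graph obtained from $G$ by expanding every vertex of $U$ into a triangle: a vertex $v$ with incident edges $e_1,e_2,e_3$ is replaced by three new mutually adjacent vertices $v_1,v_2,v_3$, with $e_i$ now incident to $v_i$ instead of $v$. $t(G)$ is the minimum size of a set $U\subseteq V(G)$ such that $G_U$ has a perfect matching. *)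

(* Defs.v *)
From mathcomp Require Import all_boot.

Set Implicit Arguments.
Unset Strict Implicit.
Unset Printing Implicit Defensive.

(* Finite loopless multigraphs: edges form a type of their own, so several     *)
(* edges may have the same pair of ends.                                      *)
Record mgraph := MGraph {
  vert : finType;
  edge : finType;
  ends : edge -> {set vert};
  card_ends : forall e, #|ends e| = 2 }.

Definition star (G : mgraph) (v : vert G) : {set edge G} :=
  [set e | v \in ends e].

Definition cubic (G : mgraph) : Prop := forall v : vert G, #|star v| = 3.

Definition simple_graph (G : mgraph) : Prop := injective (@ends G).

Definition perfect_matching (G : mgraph) (M : {set edge G}) : bool :=
  [forall v : vert G, #|M :&: star v| == 1].

Definition has_pm (G : mgraph) : bool :=
  [exists M : {set edge G}, perfect_matching M].

(* The graph G_U. The new vertices replacing v \in U are the pairs (v, e) with *)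
(* e an edge at v, and the new edges at v are the pairs (v, F) with F a        *)
(* two-element set of edges at v; for v of degree 3 this is a triangle.       *)
Section Expansion.
Variables (G : mgraph) (U : {set vert G}).

Definition old_vert : finType := {v : vert G | v \notin U}.
Definition new_vert : finType :=
  {p : vert G * edge G | (p.1 \in U) && (p.2 \in star p.1)}.
Definition new_edge : finType :=
  {p : vert G * {set edge G} |
    [&& p.1 \in U, p.2 \subset star p.1 & #|p.2| == 2]}.

Definition exp_ends (x : edge G + new_edge) : {set old_vert + new_vert} :=
  match x with
  | inl e => [set y : old_vert + new_vert |
      match y with
      | inl v => val v \in ends e
      | inr p => ((val p).1 \in ends e) && ((val p).2 == e)
      end]
  | inr q => [set y : old_vert + new_vert |
      match y with
      | inl _ => false
      | inr p => ((val p).1 == (val q).1) && ((val p).2 \in (val q).2)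
      end]
  end.

Lemma card_exp_ends x : #|exp_ends x| = 2.
Proof.
case: x => [e|[[v F] /= vF]].
  pose f (y : old_vert + new_vert) :=
    match y with inl v => val v | inr p => (val p).1 end.
  have injf : {in exp_ends (inl e) &, injective f}.
    move=> [[u uU]|[[u g] /= ug]] [[w wU]|[[w h] /= wh]]; rewrite !inE /=.
    - by move=> _ _ uw; congr inl; apply: val_inj.
    - by move=> _ _ uw; case/andP: (wh) => wU _; rewrite -uw (negPf uU) in wU.
    - by move=> _ _ uw; case/andP: (ug) => uU _; rewrite uw (negPf wU) in uU.
    - move=> /andP[_ /eqP ge] /andP[_ /eqP he] uw.
      by congr inr; apply: val_inj; rewrite /= ge he uw.
  rewrite -(card_in_imset injf) -(card_ends e); apply: eq_card => u.
  apply/imsetP/idP => [[y + ->]|ue].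
    by case: y => [[w wU]|[[w h] wh]]; rewrite inE //= => /andP[].
  case uU: (u \in U).
    have ok : ((u, e).1 \in U) && ((u, e).2 \in star (u, e).1).
      by rewrite /= uU inE.
    by exists (inr (Sub (u, e) ok)) => //; rewrite inE /= ue eqxx.
  have ok : u \notin U by rewrite uU.
  by exists (inl (Sub u ok)); rewrite ?inE.
case/and3P: (vF) => vU sF /eqP cF.
pose f (y : old_vert + new_vert) :=
  match y with inl v => None | inr p => Some (val p).2 end.
have injf : {in exp_ends (inr (Sub (v, F) vF)) &, injective f}.
  move=> [[u uU]|[[u g] /= ug]] [[w wU]|[[w h] /= wh]]; rewrite !inE //=.
  move=> /andP[/eqP uv _] /andP[/eqP wv _] [gh].
  by congr inr; apply: val_inj; rewrite /= gh uv wv.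
rewrite -(card_in_imset injf); apply: etrans cF.
rewrite -(card_imset (mem F) (@Some_inj _)).
apply: eq_card => o; apply/imsetP/imsetP => [[y + ->]|[e eF ->]].
  case: y => [[w wU]|[[w h] wh]]; rewrite inE //= => /andP[_ hF].
  by exists h.
have ok : ((v, e).1 \in U) && ((v, e).2 \in star (v, e).1).
  by rewrite /= vU (subsetP sF).
by exists (inr (Sub (v, e) ok)) => //; rewrite inE /= eqxx.
Qed.

Definition expand : mgraph :=
  @MGraph (old_vert + new_vert)%type (edge G + new_edge)%type
    exp_ends card_exp_ends.

Lemma cubic_expand : cubic G -> cubic expand.
Proof.
move=> cG [[v vU]|[[v e] /= ve]].
  rewrite -(cG v) -(card_imset (mem (star v)) (@inl_inj _ new_edge)).
  apply: eq_card => -[e|q]; rewrite !inE /=.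
    by rewrite (mem_imset _ _ (@inl_inj _ _)) inE.
  by apply/esym/negbTE/imsetP => -[].
case/andP: (ve) => vU es.
pose y : vert expand := inr (Sub (v, e) ve).
have sE : star y = inl e |: [set x in star y | ~~ is_inl x].
  apply/setP => -[g|q]; rewrite !inE /= ?andbT ?andbF ?orbF //.
  rewrite (inj_eq (@inl_inj _ _)) [e == g]eq_sym; case: eqP => [->|]; last by rewrite andbF.
  by rewrite andbT; move: es; rewrite inE.
rewrite -/y sE cardsU1 !inE /= andbF /=; congr _.+1.
pose f (x : edge expand) : {set edge G} :=
  match x with inl _ => set0 | inr q => (val q).2 :\ e end.
have injf : {in [set x in star y | ~~ is_inl x] &, injective f}.
  move=> [g|[[u F] /= uF]] [h|[[w H] /= wH]]; rewrite !inE ?andbF //= !andbT.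
  move=> /andP[/eqP vu eF] /andP[/eqP vw eH] FH.
  congr inr; apply: val_inj => /=.
  by rewrite -vu -vw -(setD1K eF) -(setD1K eH) FH.
rewrite -(card_in_imset injf).
have cs : #|star v :\ e| = 2 by have := cG v; rewrite (cardsD1 e) es => -[].
apply: etrans cs.
rewrite -(card_imset (mem (star v :\ e)) (@set1_inj _)).
apply: eq_card => S; apply/imsetP/imsetP => [[x + ->]|[g gs ->]].
  case: x => [h|[[w H] /= wH]]; rewrite !inE ?andbF //= andbT.
  case/andP=> /eqP vw eH; case/and3P: (wH) => _ sH /eqP cH.
  have /cards1P[g Hg] : #|H :\ e| == 1.
    by move: cH; rewrite (cardsD1 e) eH add1n => -[->].
  exists g => //; have : g \in H :\ e by rewrite Hg set11.
  by rewrite !inE => /andP[-> /(subsetP sH)]; rewrite inE -vw.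
have /setD1P[ge gv] := gs.
have ok : [&& (v, [set e; g]).1 \in U,
    (v, [set e; g]).2 \subset star (v, [set e; g]).1 &
    #|(v, [set e; g]).2| == 2].
  by rewrite /= vU subUset !sub1set es gv cards2 [e == g]eq_sym ge.
exists (inr (Sub (v, [set e; g]) ok)); first by rewrite !inE /= eqxx set21.
rewrite /=; apply/setP => h; rewrite !inE.
by case: (eqVneq h g) => [->|_]; rewrite ?ge ?orbT ?orbF ?andNb.
Qed.

End Expansion.

Lemma has_pm_expandT (G : mgraph) : has_pm (@expand G setT).
Proof.
apply/existsP; exists [set x | is_inl x].
apply/forallP => -[[v vU]|[[v e] /= ve]]; first by exfalso; rewrite inE in vU.
apply/cards1P; exists (inl e); apply/setP => -[g|q]; rewrite !inE //=.
rewrite (inj_eq (@inl_inj _ _)) [e == g]eq_sym.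
case: eqP => [->|]; last by rewrite andbF.
by rewrite andbT; case/andP: ve => _; rewrite inE.
Qed.

(* The minimum ranges over a nonempty family by has_pm_expandT.               *)
Definition tnum (G : mgraph) : nat :=
  #|[arg min_(U < setT | has_pm (@expand G U)) #|U|]|.

Lemma tnumP (G : mgraph) :
  (exists2 U : {set vert G}, has_pm (expand U) & #|U| = tnum G) /\
  (forall U : {set vert G}, has_pm (expand U) -> tnum G <= #|U|).
Proof.
rewrite /tnum; case: arg_minnP => [|U pU minU]; first exact: has_pm_expandT.
by split; [exists U|].
Qed.

(* Main.v *)
(* An edge set F meeting every star in 1 or 3 edges is the complement of a system
   of disjoint cycles, so t(G) is the least number of vertices missed by disjoint
   cycles of G.

   Upper bounds. For a vertex set X write d for the number of edges leaving X and
   u for the least number of vertices of X missed by disjoint cycles in X. With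
   k = 3 (k = 5 if G is simple), a set with d = 1 has at least k vertices, and we
   show (k + 1) u + 2 k <= |X| + k d if d > 0, and (k + 1) u < |X| if d = 0; the
   bounds are the case X = V(G). The inequality adds up when X is split along at
   most one edge, since a bridge contributes 1 to d on both sides. If no such split
   exists, then X is a single vertex, or all of X except d - 2 vertices of degree 2
   is covered: by Plesnik's theorem (a consequence of Tutte's), a bridgeless cubic
   graph has a perfect matching avoiding two given edges, and the other vertices
   of degree 2 are replaced by digons to make the graph cubic.

   Tightness. In a caterpillar all of whose spine edges and stems are bridges with
   odd sides, every such bridge belongs to F by parity, hence all n spine vertices
   have degree 3 in F; with leaf blocks of k vertices there are (k + 1) n + 2 k
   vertices. *)

Require Import Defs.
From mathcomp Require Import all_boot.
From mathcomp Require Import zify.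

Set Implicit Arguments.
Unset Strict Implicit.
Unset Printing Implicit Defensive.

(** * Matchings as involutions and the Tutte-Berge formula *)

Lemma even_card_involution (T : finType) (f : T -> T) (A : {set T}) :
  involutive f -> {in A, forall x, f x \in A /\ f x != x} -> ~~ odd #|A|.
Proof.
move=> ff; have [n] := ubnP #|A|; elim: n A => // n IH A ltAn Af.
have [->|/set0Pn[x xA]] := eqVneq A set0; first by rewrite cards0.
have [fxA fxx] := Af x xA.
have fxA' : f x \in A :\ x by rewrite !inE fxx.
have cA : #|A| = #|A :\ x :\ f x|.+2.
  by rewrite (cardsD1 x) xA (cardsD1 (f x) (A :\ x)) fxA'.
rewrite cA /= negbK; apply: IH => [|y]; first lia.
rewrite !inE => /and3P[yfx yx /Af[fyA fyy]]; split=> //.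
apply/and3P; split=> //; last by apply: contraNneq yfx => <-; rewrite ff.
by apply: contraNneq yx => /(can_inj ff) ->.
Qed.

Section TutteBerge.
Variables (T : finType) (e : rel T).
Hypothesis esym : symmetric e.

(* Matchings are encoded as involutions; the fixed points are the unmatched points. *)
Definition matching (W : {set T}) (f : {ffun T -> T}) :=
  [forall x, (f (f x) == x) && ((f x == x) || (x \in W) && e x (f x))].

Definition missed (W : {set T}) (f : {ffun T -> T}) := [set x in W | f x == x].

Definition max_matching (W : {set T}) (f : {ffun T -> T}) :=
  matching W f && [forall g, matching W g ==> (#|missed W f| <= #|missed W g|)].

Lemma matchingP (W : {set T}) (f : {ffun T -> T}) :
  reflect (involutive f /\ forall x, f x != x -> x \in W /\ e x (f x)) (matching W f).
Proof.
apply: (iffP forallP) => [H|[ff H] x].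
  split=> x; first by case/andP: (H x) => /eqP.
  by move=> nx; case/andP: (H x) => _; rewrite (negPf nx) => /andP.
by rewrite ff eqxx /=; case: eqP => //= /eqP /H[-> ->].
Qed.

Lemma max_matchingP (W : {set T}) (f : {ffun T -> T}) :
  reflect (matching W f /\ forall g, matching W g -> #|missed W f| <= #|missed W g|)
          (max_matching W f).
Proof.
apply: (iffP andP) => -[mf H]; split=> //.
  by move=> g mg; move/forallP/(_ g)/implyP: H; apply.
by apply/forallP => g; apply/implyP; apply: H.
Qed.

Lemma max_matching_exists W : exists f, max_matching W f.
Proof.
have m1 : matching W [ffun x => x] by apply/matchingP; split=> x; rewrite !ffunE ?eqxx.
case: (arg_minnP (fun f => #|missed W f|) m1) => f mf minf.
by exists f; apply/max_matchingP; split.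
Qed.

(** The matching pairs up the points of [W] that it does not miss. *)
Lemma odd_card_missed W f : matching W f -> odd #|missed W f| = odd #|W|.
Proof.
case/matchingP=> ff H.
have := @even_card_involution _ f (W :\: missed W f) ff.
rewrite -(cardsID (missed W f) W) oddD.
have -> : W :&: missed W f = missed W f.
  by apply/setP => x; rewrite !inE andbA andbb.
case: (odd #|W :\: _|) => [evW|_]; last by rewrite addbF.
suff /evW : {in W :\: missed W f, forall x, f x \in W :\: missed W f /\ f x != x} by [].
move=> x; rewrite !inE negb_and => /andP[+ xW].
rewrite xW /= => nx; split=> //.
have nfx : f (f x) != f x by rewrite ff eq_sym.
by have [-> _] := H _ nfx; rewrite nfx.
Qed.

(* In a graph all of whose points are missed by some maximum matching, this is
   an equivalence relation containing adjacency (Gallai's lemma). *)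
Definition inseparable W u v :=
  (u == v) || ~~ [exists f, [&& max_matching W f, u \in missed W f & v \in missed W f]].

Lemma inseparable_sym W u v : inseparable W u v = inseparable W v u.
Proof.
rewrite /inseparable eq_sym; congr (_ || ~~ _).
by apply: eq_existsb => f; congr (_ && _); rewrite andbC.
Qed.

(** [x] gets the partner [y], whose former partner [g y] becomes free. If [y] was free, the third
    test repeats the second and the edge is simply added. *)
Definition reroute (g : {ffun T -> T}) x y : {ffun T -> T} :=
  [ffun s => if s == x then y else if s == y then x
             else if s == g y then s else g s].

Lemma reroute_matching W g x y : matching W g -> g x = x ->
  x \in W -> y \in W -> e x y -> x != y -> matching W (reroute g x y).
Proof.
move=> /matchingP[gg Hg] gx xW yW exy xy.
have yx : (y == x) = false by rewrite eq_sym (negPf xy).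
apply/matchingP; split=> s; rewrite !ffunE.
  case: (eqVneq s x) => [->|sx]; first by rewrite yx eqxx.
  case: (eqVneq s y) => [->|sy]; first by rewrite eqxx.
  case: (eqVneq s (g y)) => [sz|sz]; first by rewrite (negPf sx) (negPf sy) -sz eqxx.
  have -> : (g s == x) = false by rewrite -{1}gx (can_eq gg) (negPf sx).
  have -> : (g s == y) = false by rewrite (can2_eq gg gg) (negPf sz).
  by rewrite (can_eq gg) (negPf sy) gg.
case: (eqVneq s x) => [->|sx]; first by [].
case: (eqVneq s y) => [->|sy]; first by rewrite esym.
by case: (eqVneq s (g y)) => [->|sz]; [rewrite eqxx|apply: Hg].
Qed.

Lemma missed_reroute_augment (W : {set T}) (g : {ffun T -> T}) x y : g x = x -> x \in W -> x != y -> g y = y ->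
  missed W (reroute g x y) \proper missed W g.
Proof.
move=> gx xW xy gy; apply/properP; split; last first.
  by exists x; rewrite inE xW ?gx ?eqxx //= ffunE eqxx eq_sym.
apply/subsetP => s; rewrite !inE ffunE gy => /andP[-> /=].
case: (eqVneq s x) => [->|sx]; first by rewrite gx.
by case: (eqVneq s y) => [->|sy]; first by rewrite (negPf xy).
Qed.

Lemma missed_reroute W g x y : matching W g -> g x = x -> x != y -> g y != y ->
  missed W (reroute g x y) = g y |: (missed W g :\ x).
Proof.
move=> /matchingP[gg Hg] gx xy gy.
have [gyW _] : g y \in W /\ e (g y) (g (g y)) by apply: Hg; rewrite (can_eq gg).
have gyx : g y != x by rewrite (can2_eq gg gg) gx eq_sym.
apply/setP => s; rewrite !inE ffunE.
case: (eqVneq s x) => [->|sx].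
  by rewrite eq_sym (negPf xy) andbF orbF eq_sym (negPf gyx).
case: (eqVneq s y) => [->|sy].
  by rewrite (negPf xy) andbF eq_sym (negPf gy) andbF.
by case: (eqVneq s (g y)) => [->|sz]; rewrite ?eqxx ?gyW.
Qed.

(** A maximum matching missing both ends of an edge could be enlarged by that edge. *)
Lemma adjacent_inseparable W u v : e u v -> inseparable W u v.
Proof.
move=> euv; rewrite /inseparable; case: eqVneq => //= uv.
apply/existsP => -[f /and3P[/max_matchingP[mf maxf]]].
rewrite !inE => /andP[uW /eqP fu] /andP[vW /eqP fv].
have := maxf _ (reroute_matching mf fu uW vW euv uv); rewrite leqNgt => /negP; apply.
exact/proper_card/missed_reroute_augment.
Qed.

(** The two differences have equal size, here at least 2, so a point remains when [t] is avoided. *)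
Lemma equicard_setD (A B : {set T}) u v t : #|A| = #|B| -> u != v ->
  u \in A :\: B -> v \in A :\: B -> exists2 x, x != t & x \in B :\: A.
Proof.
move=> AB uv uD vD.
have : 2 <= #|A :\: B|.
  have <- : #|[set u; v]| = 2 by rewrite cards2 uv.
  by apply: subset_leq_card; rewrite subUset !sub1set uD.
have := cardsID A B; have := cardsID B A; rewrite setIC AB => <- /addnI <- c2.
have : 0 < #|(B :\: A) :\ t|.
  by move: c2; rewrite (cardsD1 t); case: (t \in _) => //; rewrite add0n; apply: ltnW.
by case/card_gt0P => x; rewrite in_setD1 => /andP[xt xin]; exists x.
Qed.

(* The matching g below misses t and agrees with f as often as possible;
   exchanging one of its edges for an edge of f would increase the agreement. *)
Lemma inseparable_trans W u t v :
  (exists f, max_matching W f && (t \in missed W f)) ->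
  inseparable W u t -> inseparable W t v -> inseparable W u v.
Proof.
move=> [g0 Pg0] ut tv; rewrite /inseparable; case: eqVneq => //= uv.
apply/existsP => -[f /and3P[maxf uf vf]].
case/orP: ut => [/eqP ut|nut].
  by case/orP: tv uv => [/eqP <-|/existsP[]]; [rewrite ut eqxx|exists f; rewrite -ut maxf uf].
case/orP: tv => [/eqP tv|ntv].
  by case/existsP: nut; exists f; rewrite tv maxf uf.
pose agree (g : {ffun T -> T}) := [set x | f x == g x].
case: (@arg_maxnP _ g0 (fun g => max_matching W g && (t \in missed W g))
  (fun g => #|agree g|) Pg0) => g /andP[maxg tg] best.
have ug : u \notin missed W g.
  by apply: contra nut => ug; apply/existsP; exists g; rewrite maxg ug.
have vg : v \notin missed W g.
  by apply: contra ntv => vg; apply/existsP; exists g; rewrite maxg tg.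
case/max_matchingP: (maxf) => mf minf; case/max_matchingP: (maxg) => mg ming.
have cfg : #|missed W f| = #|missed W g|.
  by apply/eqP; rewrite eqn_leq minf // ming.
(* [f] and [g] miss equally many points, and only [f] misses [u] and [v]; so some [x] other than [t]
   is missed by [g] but not by [f]. *)
have [||x xt] := equicard_setD t cfg uv; rewrite ?in_setD ?ug ?vg //.
rewrite !inE => /andP[+ /andP[xW /eqP gx]]; rewrite xW /= => fx.
case/matchingP: (mf) => ff Hf; case/matchingP: (mg) => gg Hg.
have [_ exy] := Hf x fx; set y := f x in fx exy.
have fy : f y = x by rewrite /y ff.
have xy : x != y by rewrite eq_sym.
have yW : y \in W by have [] := Hf y; rewrite ?fy.
have mh := reroute_matching mg gx xW yW exy xy.
have [gy|gy] := eqVneq (g y) y.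
  have := ming _ mh; rewrite leqNgt => /negP; apply.
  exact/proper_card/missed_reroute_augment.
have mhE := missed_reroute mg gx xy gy.
have xg : x \in missed W g by rewrite inE xW gx eqxx.
have maxh : max_matching W (reroute g x y).
  apply/max_matchingP; split=> // k mk; apply: leq_trans (ming k mk).
  rewrite mhE (cardsD1 x (missed W g)) xg cardsU1.
  by rewrite leq_add2r; case: (_ \notin _).
have th : t \in missed W (reroute g x y).
  by rewrite mhE in_setU1 in_setD1 [t == x]eq_sym xt tg orbT.
have := best (reroute g x y); rewrite maxh th => /(_ isT); rewrite /= leqNgt => /negP; apply.
apply: proper_card; apply/properP; split; last first.
  by exists x; rewrite inE ?ffunE ?eqxx //= gx.
apply/subsetP => s; rewrite !inE ffunE => /eqP fgs.
case: (eqVneq s x) => [->|sx]; first by [].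
case: (eqVneq s y) => [->|sy]; first by rewrite fy.
case: (eqVneq s (g y)) => [sz|_]; last exact/eqP.
by case/eqP: sx; rewrite -fy -(ff s) fgs sz gg.
Qed.

(** This is the nontrivial inequality of the Tutte-Berge formula: [S] is a barrier, and the members
    of [P] are odd unions of components of its complement. If every point is missed by some maximum
    matching, take [S] empty and [P] the inseparability classes, each containing at most one missed
    point. Otherwise a point [v] that is never missed goes into [S]. *)
Lemma tutte_berge (W : {set T}) :
  exists S : {set T}, exists P : {set {set T}}, exists f : {ffun T -> T},
  [/\ S \subset W, trivIset P,
      forall C, C \in P -> [/\ odd #|C|, C \subset W :\: S &
        forall x y, x \in C -> y \in W :\: S -> e x y -> y \in C],
      matching W f & #|S| + #|missed W f| <= #|P|].
Proof.
have [n] := ubnP #|W|; elim: n W => // n IH W ltWn.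
have [f maxf] := max_matching_exists W.
case/max_matchingP: (maxf) => mf minf.
have [/forall_inP allmissed|] :=
  boolP [forall x in W, [exists g, max_matching W g && (x \in missed W g)]].
  have simE : {in W & &, equivalence_rel (inseparable W)}.
    move=> x y z xW yW zW; split; first by rewrite /inseparable eqxx.
    move=> xy; apply/idP/idP => H.
      by apply: (inseparable_trans _ _ H); [apply/existsP/allmissed|rewrite inseparable_sym].
    by apply: (inseparable_trans _ xy H); apply/existsP/allmissed.
  pose P := equivalence_partition (inseparable W) W.
  have partP : partition P W := equivalence_partitionP simE.
  have PE C : C \in P -> exists2 x, x \in W & C = [set y in W | inseparable W x y].
    by case/imsetP => x xW ->; exists x.
  exists set0, P, f; split=> //.
  - exact: sub0set.
  - by case/and3P: partP.
  - move=> C /PE[x xW ->]; split; last 1 first.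
    + move=> y z; rewrite !inE /= => /andP[yW xy] zW eyz; rewrite zW /=.
      apply: (inseparable_trans _ xy); last exact: adjacent_inseparable.
      exact/existsP/allmissed.
    (* A maximum matching missing [x] pairs up the rest of the class: it misses no other point of
       the class, and partners are adjacent, hence inseparable. *)
    + case/existsP: (allmissed x xW) => g /andP[maxg xg].
      case/max_matchingP: (maxg) => /matchingP[gg Hg] _.
      rewrite (cardsD1 x) !inE xW /inseparable eqxx /=.
      apply: (even_card_involution gg) => y.
      rewrite !inE => /and3P[yx yW xy]; rewrite eq_sym (negPf yx) /= in xy.
      have gy : g y != y.
        apply: contra xy => gy; apply/existsP; exists g.
        by rewrite maxg xg inE yW.
      have [_ eygy] := Hg y gy.
      have [gyW _] : g y \in W /\ e (g y) (g (g y)) by apply: Hg; rewrite gg eq_sym.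
      split=> //; rewrite gyW; apply/andP; split.
        have /eqP gx : g x == x by move: xg; rewrite inE => /andP[].
        by rewrite -gx (can_eq gg).
      apply: (inseparable_trans _ _ (adjacent_inseparable W eygy)); first exact/existsP/allmissed.
      by rewrite /inseparable xy orbT.
    + by apply/subsetP => y; rewrite !inE => /andP[].
  - rewrite cards0 add0n.
    pose cl x := [set y in W | inseparable W x y].
    have injcl : {in missed W f &, injective cl}.
      move=> x y xf yf cxy.
      have : y \in cl x by rewrite cxy inE /inseparable eqxx; move: yf; rewrite inE => /andP[-> _].
      rewrite inE => /andP[_ /orP[/eqP //|/existsP[]]].
      by exists f; rewrite maxf xf.
    rewrite -(card_in_imset injcl); apply: subset_leq_card.
    by apply/subsetP => _ /imsetP[x xf ->]; apply: imset_f; move: xf; rewrite inE => /andP[].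
case/forall_inPn => v vW /existsPn nov.
have [|S [P [g [SW tP HP mg leP]]]] := IH (W :\ v).
  by have := cardsD1 v W; rewrite vW; lia.
have WE : W :\: (v |: S) = (W :\ v) :\: S.
  by apply/setP => x; rewrite !inE negb_or; case: (x == v); case: (x \in S).
exists (v |: S), P, f; split=> //.
- by rewrite subUset sub1set vW; apply: subset_trans SW (subsetDl _ _).
- by move=> C CP; have [oC CW cC] := HP C CP; rewrite WE.
have vS : v \notin S by apply/negP => /(subsetP SW); rewrite !inE eqxx.
rewrite cardsU1 vS; suff : #|missed W f| < #|missed (W :\ v) g| by lia.
case/matchingP: (mg) => gg Hg.
have mgW : matching W g.
  by apply/matchingP; split=> // x /Hg[+ ->]; rewrite !inE => /andP[].
have gv : g v = v by apply/eqP; apply: contraT => /Hg[]; rewrite !inE eqxx.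
have missE : missed W g = v |: missed (W :\ v) g.
  apply/setP => x; rewrite !inE; case: (eqVneq x v) => [->|//].
  by rewrite gv vW eqxx.
have cmiss : #|missed W g| = #|missed (W :\ v) g|.+1.
  by rewrite missE cardsU1 !inE eqxx.
(* Equality would make [g] a maximum matching missing [v]; otherwise parity widens the gap to
   two. *)
have := minf g mgW; rewrite leq_eqVlt => /orP[/eqP eqm|lt].
  have := nov g; rewrite missE !inE eqxx andbT => /negP[].
  by apply/max_matchingP; split=> // h mh; rewrite -eqm minf.
have := odd_card_missed mf; rewrite -(odd_card_missed mgW) cmiss; lia.
Qed.

End TutteBerge.

(** * Degrees, cuts and the handshake identity *)

Section Degrees.
Variables (V E : finType) (ends : E -> {set V}).

Definition deg (D : {set E}) (v : V) := #|[set e in D | v \in ends e]|.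

Definition cut (D : {set E}) (A : {set V}) := [set e in D | #|ends e :&: A| == 1].

Lemma sum_deg (D : {set E}) (A : {set V}) :
  \sum_(v in A) deg D v = \sum_(e in D) #|ends e :&: A|.
Proof.
transitivity (\sum_(v in A) \sum_(e in D | v \in ends e) 1).
  by apply: eq_bigr => v _; rewrite sum1dep_card; apply: eq_card => e; rewrite !inE.
rewrite (exchange_big_dep (mem D)) /=; last by move=> v e _ /andP[].
apply: eq_bigr => e eD; rewrite sum1dep_card; apply: eq_card => v.
by rewrite !inE eD andbC.
Qed.

Lemma handshake (D : {set E}) (A : {set V}) :
  {in D, forall e, #|ends e| = 2} ->
  \sum_(v in A) deg D v = #|cut D A| + #|[set e in D | ends e \subset A]|.*2.
Proof.
move=> e2; rewrite sum_deg.
have cnt (p : pred E) : #|[set e in D | p e]| = \sum_(e in D) p e.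
  by rewrite -sum1dep_card big_mkcondr; apply: eq_bigr => e _; case: (p e).
rewrite !cnt -muln2 big_distrl -big_split /=; apply: eq_bigr => e eD.
have := e2 e eD; have [eA|eA] := boolP (ends e \subset A).
  by rewrite (setIidPl eA) => ->.
have : #|ends e :&: A| < #|ends e|.
  by apply: proper_card; rewrite properE subsetIl subsetI subxx.
by move=> + e2'; rewrite e2'; case: #|_| => [|[]].
Qed.

Lemma degU (D1 D2 : {set E}) v : [disjoint D1 & D2] -> deg (D1 :|: D2) v = deg D1 v + deg D2 v.
Proof.
move=> dis; rewrite /deg -cardsUI.
have -> : [set e in D1 | v \in ends e] :&: [set e in D2 | v \in ends e] = set0.
  apply/setP => e; rewrite !inE; apply/negP => /andP[/andP[e1 _] /andP[e2 _]].
  by rewrite (disjointFr dis e1) in e2.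
rewrite cards0 addn0; apply: eq_card => e; rewrite !inE.
by case: (_ \in ends e); rewrite ?andbT ?andbF.
Qed.

Lemma degD (D M : {set E}) v : M \subset D -> deg (D :\: M) v = deg D v - deg M v.
Proof.
move=> MD; rewrite -{2}(setID D M) (setIidPr MD) degU ?addKn //.
by rewrite -setI_eq0 setIC setDE -setIA [~: _ :&: _]setIC setICr setI0.
Qed.

Lemma deg0 (D : {set E}) v : {in D, forall e, v \notin ends e} -> deg D v = 0.
Proof.
move=> H; apply/eqP; rewrite cards_eq0; apply/eqP/setP => e; rewrite !inE.
by apply/negP => /andP[/H /negP].
Qed.

End Degrees.

(** * Plesnik's theorem *)

Section Plesnik.
Variables (V E : finType) (ends : E -> {set V}) (X : {set V}) (D : {set E}).
(** The vertices of [Ch] act as subdivision points on the two edges to be avoided: the matching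
    sought covers exactly the rest of [X]. *)
Variable Ch : {set V}.
Hypothesis ends2 : {in D, forall e, #|ends e| = 2}.
Hypothesis endsX : {in D, forall e, ends e \subset X}.
Hypothesis ChX : Ch \subset X.
Hypothesis card_Ch : #|Ch| <= 2.
Hypothesis deg_Ch : {in Ch, forall v, deg ends D v = 2}.
Hypothesis deg_X : {in X :\: Ch, forall v, deg ends D v = 3}.
Hypothesis conn : forall A : {set V}, A \proper X -> A != set0 -> 2 <= #|cut ends D A|.

Let adj x y := [exists e in D, ends e == [set x; y]].

Lemma adj_sym : symmetric adj.
Proof. by move=> x y; rewrite /adj setUC. Qed.

Lemma cutX_empty : cut ends D X = set0.
Proof.
apply/setP => e; rewrite !inE; apply/negP => /andP[eD].
by rewrite (setIidPl (endsX eD)) ends2.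
Qed.

(** Counting degrees makes the cut odd, and [conn] excludes the value 1. *)
Lemma cut_odd_ge3 (C : {set V}) : C \subset X :\: Ch -> odd #|C| -> 3 <= #|cut ends D C|.
Proof.
move=> CX oC; have CX' := subset_trans CX (subsetDl _ _).
have : odd #|cut ends D C|.
  have := handshake C ends2.
  rewrite (eq_bigr (fun=> 3)); last by move=> v vC; apply/deg_X/(subsetP CX).
  by rewrite sum_nat_const => /(congr1 odd); rewrite oddM oC oddD odd_double addbF => <-.
have C0 : C != set0 by apply: contraTneq oC => ->; rewrite cards0.
have [CX0|nCX] := eqVneq C X; first by rewrite CX0 cutX_empty cards0.
have pC : C \proper X by rewrite properEneq nCX.
by have := conn pC C0; case: #|_| => [|[|[]]].
Qed.

Lemma even_card_unchosen : ~~ odd #|X :\: Ch|.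
Proof.
have := handshake X ends2; rewrite cutX_empty cards0 add0n (big_setID Ch) /=.
rewrite (setIidPr ChX) (eq_bigr (fun=> 2)) // [X in _ + X](eq_bigr (fun=> 3)) //.
by rewrite !sum_nat_const => /(congr1 odd); rewrite oddD !oddM odd_double andbF andbT /= => ->.
Qed.

Lemma pm_of_matching f : matching adj (X :\: Ch) f -> missed (X :\: Ch) f = set0 ->
  exists2 M : {set E}, M \subset D & {in X, forall v, deg ends M v = (v \notin Ch)}.
Proof.
set W := X :\: Ch; move=> /matchingP[ff Hf] m0.
have fW x : x \in W -> f x != x.
  by move=> xW; apply/negP => fx; move/setP/(_ x): m0; rewrite !inE fx -in_setD xW.
have ex x : x \in W -> exists e, (e \in D) && (ends e == [set x; f x]).
  by move=> /fW/Hf[_ /existsP].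
(* [pick] chooses one among parallel edges; the choice depends only on the pair of ends, so [x] and
   [f x] select the same edge. *)
pose M := [set e | [exists x in W, [pick e in D | ends e == [set x; f x]] == Some e]].
have ME e : e \in M -> exists x, [/\ x \in W, e \in D, ends e = [set x; f x] &
    [pick e in D | ends e == [set x; f x]] = Some e].
  rewrite inE => /existsP[x /andP[xW /eqP px]]; exists x; split=> //.
    by move: px; case: pickP => // e' /andP[e'D _] [<-].
  by move: px; case: pickP => // e' /andP[_ /eqP e'D] [<-].
exists M => [|v vX]; first by apply/subsetP => e /ME[x []].
have fWW x : x \in W -> f x \in W.
  by move=> xW; have [] // := Hf (f x); rewrite ff eq_sym fW.
have [vC|vC] := boolP (v \in Ch).
  apply: deg0 => e /ME[x [xW _ -> _]].
  have /setDP[_ fxC] := fWW _ xW; have /setDP[_ xC] := xW.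
  rewrite !inE negb_or; apply/andP.
  by split; apply: contraTneq vC => ->.
have vW : v \in W by rewrite inE vC.
case pv: [pick e in D | ends e == [set v; f v]] => [e|]; last first.
  by move: pv; case: pickP => // H; have [e] := ex v vW; rewrite H.
have [eD /eqP ev] : e \in D /\ ends e == [set v; f v].
  by move: pv; case: pickP => // e' /andP[? ?] [<-].
apply/eqP/cards1P; exists e; apply/setP => e'; rewrite in_set1 in_set.
apply/andP/eqP => [[/ME[x [xW e'D e'x px]]]|->].
  rewrite e'x !inE => /orP[]/eqP vx; first by move: px; rewrite -vx pv => -[].
  have xv : x = f v by rewrite vx ff.
  by move: px; rewrite xv ff setUC pv => -[].
by rewrite ev !inE eqxx; split=> //; apply/existsP; exists v; rewrite vW pv eqxx.
Qed.

(* If Tutte's condition fails, the barrier S has at least #|S| + 2 odd components,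
   each sending at least three edges to S or to the at most two vertices of Ch. *)
Lemma plesnik : exists2 M : {set E}, M \subset D & {in X, forall v, deg ends M v = (v \notin Ch)}.
Proof.
have [S [P [f [SW tP HP mf leP]]]] := tutte_berge adj_sym (X :\: Ch).
have om := odd_card_missed mf; rewrite (negPf even_card_unchosen) in om.
have [m0|m0] := eqVneq (missed (X :\: Ch) f) set0; first exact: pm_of_matching mf m0.
have m2 : 2 <= #|missed (X :\: Ch) f|.
  by move: m0 om; rewrite -cards_eq0; case: #|_| => [|[]].
(* The other end of the edge lies outside [C], which is closed under adjacency in
   [X :\: Ch :\: S]. *)
have outC C e : C \in P -> e \in cut ends D C ->
    exists2 s, s \in S :|: Ch & s \in ends e.
  move=> CP; have [_ CW closed] := HP C CP; rewrite inE => /andP[eD /cards1P[x xE]].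
  have : x \in ends e :&: C by rewrite xE set11.
  rewrite inE => /andP[xe xC].
  have /cards1P[y yE] : #|ends e :\ x| == 1.
    by have := ends2 eD; rewrite (cardsD1 x) xe add1n => -[->].
  have : y \in ends e :\ x by rewrite yE set11.
  rewrite !inE => /andP[yx ye].
  exists y => //; have yX := subsetP (endsX eD) y ye.
  rewrite inE; apply: contraT; rewrite negb_or => /andP[yS yCh].
  have : y \in ends e :&: C.
    rewrite inE ye; apply: (closed x) => //; first by rewrite !inE yS yCh.
    by apply/existsP; exists e; rewrite eD -(setD1K xe) yE eqxx.
  by rewrite xE inE (negPf yx).
have le3 : 3 * #|P| <= \sum_(C in P) #|cut ends D C|.
  rewrite mulnC -sum_nat_const; apply: leq_sum => C /HP[oC CW _].
  by apply: cut_odd_ge3 => //; apply: subset_trans CW (subsetDl _ _).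
have leS : \sum_(s in S :|: Ch) deg ends D s <= 3 * #|S| + 4.
  have dSC : [disjoint S & Ch].
    by rewrite disjoints_subset; apply/subsetP => s /(subsetP SW); rewrite !inE => /andP[].
  rewrite (eq_bigl (mem [predU S & Ch])); last by move=> s; rewrite !inE.
  rewrite bigU //= (eq_bigr (fun=> 3)); last by move=> s /(subsetP SW) /deg_X.
  rewrite [X in _ + X](eq_bigr (fun=> 2)) // !sum_nat_const mulnC leq_add2l mulnC.
  by rewrite (leq_mul2l 2 _ 2).
(* An edge with an end in [S :|: Ch] has at most one end in the union of [P], so it is in the cut of
   at most one member of [P]. *)
have leC : \sum_(C in P) #|cut ends D C| <= \sum_(s in S :|: Ch) deg ends D s.
  rewrite sum_deg.
  have -> : \sum_(C in P) #|cut ends D C| = \sum_(e in D) \sum_(C in P | e \in cut ends D C) 1.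
    rewrite (exchange_big_dep (mem P)) /=; last by move=> e C _ /andP[].
    apply: eq_bigr => C CP; rewrite sum1dep_card; apply: eq_card => e.
    by rewrite !inE CP /=; case: (e \in D).
  apply: leq_sum => e eD; rewrite sum1dep_card.
  have [->|/set0Pn[C]] := eqVneq [set C in P | e \in cut ends D C] set0; first by rewrite cards0.
  rewrite inE => /andP[CP eC]; have [s sS se] := outC C e CP eC.
  apply: (@leq_trans 1); last by apply/card_gt0P; exists s; rewrite inE se.
  rewrite -(cards1 C); apply: subset_leq_card; apply/subsetP => C'.
  rewrite inE => /andP[C'P eC'].
  have cutin B : B \in P -> e \in cut ends D B -> exists2 x, x \in B & ends e = [set s; x].
    move=> BP; rewrite inE => /andP[_ /cards1P[x xE]].
    have : x \in ends e :&: B by rewrite xE set11.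
    rewrite inE => /andP[xe xB]; exists x => //.
    have [_ BW _] := HP B BP.
    have sx : s != x.
      apply: contraTneq sS => ->; have := subsetP BW x xB.
      by rewrite !inE => /and3P[/negPf -> /negPf ->].
    by apply/esym/eqP; rewrite eqEcard subUset !sub1set se xe cards2 sx ends2.
  have [x xC ex] := cutin C CP eC; have [y yC' ey] := cutin C' C'P eC'.
  have xy : x = y.
    have := setU11 y [set s]; rewrite setUC -ey ex !inE => /orP[/eqP ys|/eqP -> //].
    by move: (ends2 eD); rewrite ey ys setUid cards1.
  rewrite inE eq_sym; apply: contraT => nCC'.
  have := disjointFr (trivIsetP tP C C' CP C'P nCC') xC; by rewrite xy yC'.
(* Since [#|P|] is at least [#|S| + 2], this would give [3 * #|S| + 6 <= 3 * #|S| + 4]. *)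
have : 3 * #|P| <= 3 * #|S| + 4 by apply: leq_trans le3 (leq_trans leC leS).
move: leP m2; move: #|S| #|P| #|missed _ _| => a b c; clear; lia.
Qed.

End Plesnik.

(** * Digons and cycle covers of 2-edge-connected blocks *)

Lemma card_sum_set (A B : finType) (C : {set A + B}) :
  #|C| = #|[set a | inl a \in C]| + #|[set b | inr b \in C]|.
Proof.
rewrite -sum1_card big_sumType /= -!sum1dep_card.
by congr (_ + _); apply: eq_bigl.
Qed.

(* A vertex u of degree 2 is replaced by u and a new vertex None, joined by a double
   edge; the edge e1 at u is moved to None. *)
Section Digon.
Variables (V E : finType) (ends : E -> {set V}) (u : V) (e1 : E).
Hypothesis ue1 : u \in ends e1.

Definition digon_ends (x : E + bool) : {set option V} :=
  match x with
  | inl e => [set y | match y with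
      | None => e == e1
      | Some v => (v \in ends e) && ~~ ((v == u) && (e == e1)) end]
  | inr _ => [set None; Some u]
  end.

Definition old_edges (C : {set E + bool}) := [set e | inl e \in C].
Definition digon_edges (C : {set E + bool}) := [set b | inr b \in C].

Lemma deg_digon C y : deg digon_ends C y =
  #|[set e in old_edges C | y \in digon_ends (inl e)]| +
  (y \in [set None; Some u]) * #|digon_edges C|.
Proof.
rewrite /deg card_sum_set; congr (_ + _).
  by apply: eq_card => e; rewrite !inE.
have [yu|yu] := boolP (y \in _).
  by rewrite mul1n; apply: eq_card => b; rewrite !inE -[X in _ && X]in_set2 yu andbT.
rewrite mul0n; apply/eqP; rewrite cards_eq0; apply/eqP/setP => b.
by rewrite !inE -[X in _ && X]in_set2 (negPf yu) andbF.
Qed.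

Lemma deg_digon_old C v : v != u ->
  deg digon_ends C (Some v) = deg ends (old_edges C) v.
Proof.
move=> vu; rewrite deg_digon !inE /= (inj_eq Some_inj) (negPf vu) addn0.
by apply: eq_card => e; rewrite !inE (negPf vu) andbT.
Qed.

Lemma deg_digon_None C :
  deg digon_ends C None = (inl e1 \in C) + #|digon_edges C|.
Proof.
rewrite deg_digon !inE /= mul1n; congr (_ + _).
have [e1C|e1C] := boolP (inl e1 \in C).
  by rewrite [RHS]/= -(cards1 e1); apply: eq_card => e; rewrite !inE; case: eqP => [->|]; rewrite ?e1C ?andbF.
apply/eqP; rewrite cards_eq0; apply/eqP/setP => e; rewrite !inE.
by case: eqP => [->|]; rewrite ?(negPf e1C) ?andbF.
Qed.

(** The edge [e1] is at [u] only before the replacement, whence the correction on the left. *)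
Lemma deg_digon_Some C :
  deg digon_ends C (Some u) + (inl e1 \in C) = deg ends (old_edges C) u + #|digon_edges C|.
Proof.
rewrite deg_digon !inE eqxx orbT mul1n addnAC; congr (_ + _).
rewrite /deg (cardsD1 e1 [set e in old_edges C | u \in ends e]) !inE ue1 andbT addnC.
congr (_ + _); apply: eq_card => e; rewrite !inE eqxx /=.
by case: (e == e1); rewrite ?andbF ?andbT.
Qed.

(** A set that does not separate the ends of the digon can be pulled back along its contraction
    [p]. *)
Lemma card_digon_endsI e (A : {set option V}) : (None \in A) = (Some u \in A) ->
  #|digon_ends (inl e) :&: A| = #|ends e :&: [set v | Some v \in A]|.
Proof.
move=> NA; pose p := odflt u.
have injp : {in digon_ends (inl e) :&: A &, injective p}.
  move=> [v|] [w|]; rewrite !inE /p //=.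
  - by move=> _ _ ->.
  - by move=> /andP[/andP[_ nv] _] /andP[ee _] vu; rewrite vu eqxx ee in nv.
  - by move=> /andP[ee _] /andP[/andP[_ nv] _] vu; rewrite -vu eqxx ee in nv.
rewrite -(card_in_imset injp); apply: eq_card => v; rewrite !inE.
apply/imsetP/andP => [[[w|]]|[ve vA]].
- by rewrite !inE => /andP[/andP[we _] wA] ->.
- by rewrite !inE NA => /andP[/eqP -> uA] ->.
have [/andP[/eqP vu /eqP ee]|nv] := boolP ((v == u) && (e == e1)).
  by exists None => //; rewrite !inE ee eqxx NA -vu.
by exists (Some v) => //; rewrite !inE ve nv vA.
Qed.

End Digon.

(* C is the complement of a matching: splitting the vertices of degree 2 outside Ch
   into digons leaves a graph to which Plesnik's theorem applies. *)
Lemma cycle_cover n (V E : finType) (ends : E -> {set V}) (X Ch : {set V}) (D : {set E}) :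
  {in D, forall e, #|ends e| = 2} -> {in D, forall e, ends e \subset X} ->
  Ch \subset X -> #|Ch| <= 2 -> {in Ch, forall v, deg ends D v = 2} ->
  {in X, forall v, deg ends D v = 2 \/ deg ends D v = 3} ->
  (forall A : {set V}, A \proper X -> A != set0 -> 2 <= #|cut ends D A|) ->
  #|[set v in X :\: Ch | deg ends D v == 2]| <= n ->
  exists2 C : {set E}, C \subset D & {in X, forall v, deg ends C v = 2 \/
    [/\ deg ends C v = 0, deg ends D v = 2 & v \notin Ch]}.
Proof.
elim: n V E ends X Ch D => [|n IH] V E ends X Ch D ends2 endsX ChX Ch2 degCh degX conn len.
  have deg3 : {in X :\: Ch, forall v, deg ends D v = 3}.
    move=> v vXC; have [d2|//] := degX v (subsetP (subsetDl _ _) v vXC).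
    move: len; rewrite leqn0 cards_eq0 => /eqP/setP/(_ v); by rewrite in_set vXC d2 in_set0.
  (* The complement of the matching has degree 3 - 1 outside [Ch] and 2 - 0 in [Ch]. *)
  have [M MD Mv] := plesnik ends2 endsX ChX Ch2 degCh deg3 conn.
  exists (D :\: M) => [|v vX]; first exact: subsetDl.
  left; rewrite degD // Mv //; have [vC|vC] := boolP (v \in Ch); first by rewrite degCh.
  by rewrite deg3 // inE vC.
have [E0|/set0Pn[u]] := eqVneq [set v in X :\: Ch | deg ends D v == 2] set0.
  by apply: IH => //; rewrite E0 cards0.
rewrite inE => /andP[uXC /eqP u2]; have /setDP[uX uC] := uXC.
have /card_gt0P[e1] : 0 < #|[set e in D | u \in ends e]| by rewrite -/(deg ends D u) u2.
rewrite inE => /andP[e1D ue1].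
pose X' := None |: Some @: X.
have X'S v : (Some v \in X') = (v \in X) by rewrite !inE (mem_imset _ _ Some_inj).
pose Ch' : {set option V} := Some @: Ch.
have Ch'S v : (Some v \in Ch') = (v \in Ch) by rewrite (mem_imset _ _ Some_inj).
have Ch'N : None \notin Ch' by apply/imsetP => -[].
pose D' := [set x : E + bool | if x is inl e then e \in D else true].
have oD : old_edges D' = D by apply/setP => e; rewrite !inE.
have dD : #|digon_edges D'| = 2.
  by rewrite -card_bool -cardsT; apply: eq_card => b; rewrite !inE.
pose ends' := digon_ends ends u e1.
have degN : deg ends' D' None = 3 by rewrite deg_digon_None inE e1D dD.
have degu : deg ends' D' (Some u) = 3.
  by have := deg_digon_Some ue1 D'; rewrite inE e1D oD u2 dD addn1 => -[].
have degS v : v != u -> deg ends' D' (Some v) = deg ends D v.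
  by move=> vu; rewrite deg_digon_old // oD.
have [||||||||C' C'D H] := IH _ _ ends' X' Ch' D'.
- move=> [e|b]; rewrite inE => eD; last by rewrite cards2.
  rewrite -[ends' _]setIT card_digon_endsI ?inE // -(ends2 e eD).
  by apply: eq_card => v; rewrite !inE andbT.
- move=> [e|b]; rewrite inE => eD; apply/subsetP => -[v|]; rewrite ?X'S ?inE //=.
    by case/andP => ve _; apply: (subsetP (endsX e eD)).
  by rewrite (inj_eq Some_inj) => /eqP ->.
- by apply/subsetP => -[v|]; rewrite ?Ch'S ?X'S ?(negPf Ch'N) //; apply: subsetP.
- by rewrite card_imset //; apply: Some_inj.
- move=> _ /imsetP[v vC ->]; rewrite degS ?degCh //.
  by apply: contraNneq uC => <-.
- move=> [v|]; last by right.
  rewrite X'S => vX; have [->|vu] := eqVneq v u; first by right.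
  by rewrite degS //; apply: degX.
(* If [A] separates the ends of the digon, both digon edges are cut; otherwise contracting the digon
   reduces the claim to [conn]. *)
- move=> A pA A0; have [NA|NA] := eqVneq (None \in A) (Some u \in A); last first.
    rewrite -card_bool -cardsT -(card_imset _ (@inr_inj E bool)).
    apply: subset_leq_card; apply/subsetP => _ /imsetP[b _ ->]; rewrite inE; apply/andP.
    split; first by rewrite inE.
    rewrite setIUl; case: (boolP (Some u \in A)) NA => uA NA.
      have {}NA : None \notin A by move: NA; case: (None \in A).
      have -> : [set None] :&: A = set0.
        by apply/setP => y; rewrite !inE; case: eqP => // ->; apply/negbTE.
      by rewrite set0U (setIidPl _) ?cards1 // sub1set.
    have {}NA : None \in A by move: NA; case: (None \in A).
    have -> : [set Some u] :&: A = set0.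
      by apply/setP => y; rewrite !inE; case: eqP => // ->; apply/negbTE.
    by rewrite setU0 (setIidPl _) ?cards1 // sub1set.
  pose B := [set v | Some v \in A].
  have AX y : y \in A -> y \in X' by apply/subsetP; case/properP: pA.
  have BX : B \proper X.
    rewrite properEneq; apply/andP; split; last first.
      by apply/subsetP => v; rewrite inE => /AX; rewrite X'S.
    apply: contraTneq pA => BX; rewrite properE negb_and; apply/orP; right.
    have Bv v : v \in X -> Some v \in A by rewrite -BX inE.
    rewrite negbK; apply/subsetP => -[v|]; first by rewrite X'S => /Bv.
    by rewrite NA Bv.
  have B0 : B != set0.
    apply: contraNneq A0 => B0.
    have Bv v : (Some v \in A) = false by move/setP/(_ v): B0; rewrite !inE.
    by apply/eqP/setP => -[v|]; rewrite ?inE ?Bv // NA Bv.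
  apply: leq_trans (conn B BX B0) _; rewrite -(card_imset _ (@inl_inj E bool)).
  apply: subset_leq_card; apply/subsetP => _ /imsetP[e + ->].
  by rewrite !inE => /andP[-> /=]; rewrite -(card_digon_endsI ue1).
- rewrite -ltnS; apply: leq_trans len; rewrite (cardsD1 u) inE uXC u2 eqxx ltnS.
  rewrite -[X in _ <= X](card_imset _ Some_inj); apply: subset_leq_card; apply/subsetP => -[v|].
    rewrite in_set => /andP[]; rewrite in_setD Ch'S X'S => /andP[vC vX].
    have [->|vu] := eqVneq v u; first by rewrite degu.
    rewrite degS // => v2; rewrite (mem_imset _ _ Some_inj).
    by rewrite !inE vu vC vX v2.
  by rewrite in_set degN andbF.
exists (old_edges C').
  by apply/subsetP => e; rewrite inE => /(subsetP C'D); rewrite inE.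
move=> v vX; have [->|vu] := eqVneq v u; last first.
  have := H (Some v); rewrite X'S => /(_ vX).
  by rewrite deg_digon_old // degS // Ch'S.
have N2 : deg ends' C' None = 2.
  by case: (H None); rewrite ?degN ?inE // => -[].
have S2 : deg ends' C' (Some u) = 2.
  by case: (H (Some u)); rewrite ?degu ?X'S // => -[].
have le2 : deg ends (old_edges C') u <= 2.
  rewrite -u2; apply: subset_leq_card; apply/subsetP => e; rewrite !inE.
  by case/andP => /(subsetP C'D); rewrite inE => -> ->.
(* If [e1] is in [C'], exactly one digon edge is used, and contraction leaves degree 2 at [u].
   Otherwise the digon is itself a cycle of [C'], and [u] becomes a missed vertex. *)
have := deg_digon_Some ue1 C'; rewrite -/ends' S2.
move: N2; rewrite deg_digon_None; case: (_ \in C') => /=; move: le2.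
  rewrite add1n => _ [->] [H2]; left; lia.
by rewrite add0n => _ -> H2; right; split=> //; lia.
Qed.

(** * Cycle covers in cubic graphs and the upper bounds *)

Lemma subset_of_card (T : finType) (A : {set T}) k :
  k <= #|A| -> exists2 B : {set T}, B \subset A & #|B| = k.
Proof.
move=> kA; exists [set x in take k (enum A)].
  by apply/subsetP => x; rewrite inE => /mem_take; rewrite mem_enum.
rewrite cardsE (card_uniqP _) ?take_uniq ?enum_uniq // size_take -cardE.
by case: ltngtP kA.
Qed.

Section CycleCovers.
Variable G : mgraph.
Implicit Types (X A B : {set vert G}) (C : {set edge G}) (v : vert G).

Definition inner X : {set edge G} := [set e | ends e \subset X].

Definition boundary X := #|cut (@ends G) setT X|.

(** Degrees 0 and 2 describe a system of disjoint cycles; the vertices of degree 0 are the missed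
    ones. *)
Definition covered_but X m := exists C, [/\ C \subset inner X,
  {in X, forall v, deg (@ends G) C v = 0 \/ deg (@ends G) C v = 2} &
  #|[set v in X | deg (@ends G) C v == 0]| <= m].

Lemma covered_butU A B a b : [disjoint A & B] ->
  covered_but A a -> covered_but B b -> covered_but (A :|: B) (a + b).
Proof.
move=> dAB [C1 [C1A H1 m1]] [C2 [C2B H2 m2]].
have inC (C X : {set _}) v e : C \subset inner X -> e \in C -> v \in ends e -> v \in X.
  by move=> CX /(subsetP CX); rewrite inE => /subsetP; apply.
have dC : [disjoint C1 & C2].
  rewrite -setI_eq0; apply/set0Pn => -[e /setIP[e1 e2]].
  have /card_gt0P[v ve] : 0 < #|ends e| by rewrite card_ends.
  by have := disjointFr dAB (inC _ _ _ _ C1A e1 ve); rewrite (inC _ _ _ _ C2B e2 ve).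
have dA v : v \in A -> deg (@ends G) (C1 :|: C2) v = deg (@ends G) C1 v.
  move=> vA; rewrite degU // [X in _ + X]deg0 ?addn0 // => e e2.
  by apply/negP => /(inC _ _ _ _ C2B e2); rewrite (disjointFr dAB vA).
have dB v : v \in B -> deg (@ends G) (C1 :|: C2) v = deg (@ends G) C2 v.
  move=> vB; rewrite degU // [X in X + _]deg0 ?add0n // => e e1.
  by apply/negP => /(inC _ _ _ _ C1A e1); rewrite (disjointFl dAB vB).
exists (C1 :|: C2); split.
- apply/subsetP => e /setUP[/(subsetP C1A)|/(subsetP C2B)]; rewrite !inE => /subset_trans; apply.
    exact: subsetUl.
  exact: subsetUr.
- by move=> v /setUP[vA|vB]; [rewrite dA //; apply: H1|rewrite dB //; apply: H2].
apply: leq_trans (leq_add m1 m2); apply: leq_trans _ (leq_card_setU _ _).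
apply: subset_leq_card; apply/subsetP => v; rewrite !inE => /andP[/orP[vA|vB]].
  by rewrite dA // => ->; rewrite vA.
by rewrite dB // => ->; rewrite vB orbT.
Qed.

(** An edge between [A] and [X :\: A] counts on both sides on the left, but not in [boundary X]. *)
Lemma boundary_split X A : A \subset X ->
  boundary A + boundary (X :\: A) = boundary X + (#|cut (@ends G) (inner X) A|).*2.
Proof.
move=> AX.
have cnt (D : {set edge G}) (p : pred (edge G)) :
    #|[set e in D | p e]| = \sum_(e : edge G) ((e \in D) && p e : nat).
  rewrite -sum1dep_card big_mkcond; apply: eq_bigr => e _.
  by case: (_ && _).
rewrite /boundary !cnt -muln2 big_distrl -!big_split /=; apply: eq_bigr => e _.
rewrite !inE /=.
have cX : #|ends e :&: X| = #|ends e :&: A| + #|ends e :&: (X :\: A)|.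
  rewrite -(cardsID A (ends e :&: X)); congr (_ + _); apply: eq_card => v; rewrite !inE.
    by case: (boolP (v \in A)) => [/(subsetP AX) ->|]; rewrite ?andbT ?andbF.
  by rewrite andbCA.
have eX : (ends e \subset X) = (#|ends e :&: X| == 2).
  apply/idP/eqP => [/setIidPl ->|c2]; first exact: card_ends.
  by apply/setIidPl/eqP; rewrite eqEcard subsetIl c2 card_ends.
have := subset_leq_card (subsetIl (ends e) X); rewrite eX card_ends cX.
by case: #|ends e :&: A| => [|[|[]]] //; case: #|ends e :&: _| => [|[|[]]].
Qed.

Lemma cut_setD X A : A \subset X ->
  cut (@ends G) (inner X) (X :\: A) = cut (@ends G) (inner X) A.
Proof.
move=> AX; apply/setP => e; rewrite !inE; case: (boolP (_ \subset X)) => //= eX.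
have : #|ends e :&: A| + #|ends e :&: (X :\: A)| = 2.
  rewrite -(card_ends e) -(cardsID A (ends e)); congr (_ + _); apply: eq_card => v.
  rewrite !inE andbC andbAC; case: (boolP (v \in ends e)) => [/(subsetP eX) ->|]; by rewrite ?andbT ?andbF.
by case: #|ends e :&: A| => [|[|[]]] //=; case: #|ends e :&: _| => [|[|[]]].
Qed.

Lemma cut_inner_boundary X A : #|cut (@ends G) (inner X) A| <= boundary A.
Proof. by apply: subset_leq_card; apply/subsetP => e; rewrite !inE => /andP[_]. Qed.

Hypothesis cubicG : cubic G.

Lemma deg_cubic v : deg (@ends G) setT v = 3.
Proof. by rewrite -(cubicG v); apply: eq_card => e; rewrite !inE. Qed.

Lemma cubic_handshake X : 3 * #|X| = boundary X + (#|inner X|).*2.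
Proof.
have := @handshake _ _ (@ends G) setT X (fun e _ => card_ends e).
rewrite (eq_bigr (fun=> 3)) => [|v _]; last exact: deg_cubic.
rewrite sum_nat_const mulnC => ->; congr (_ + _.*2).
by apply: eq_card => e; rewrite !inE.
Qed.

Lemma sum_deg_inner X : \sum_(v in X) deg (@ends G) (inner X) v = (#|inner X|).*2.
Proof.
rewrite handshake; last by move=> e _; apply: card_ends.
have -> : cut (@ends G) (inner X) X = set0.
  apply/setP => e; rewrite !inE; apply/negP => /andP[eX].
  by rewrite (setIidPl eX) card_ends.
by rewrite cards0 add0n; congr _.*2; apply: eq_card => e; rewrite !inE andbb.
Qed.

Lemma boundary1 v : boundary [set v] = 3.
Proof.
rewrite -(cubicG v); apply: eq_card => e; rewrite !inE /=.
have [ve|ve] := boolP (v \in ends e).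
  by rewrite (setIidPr _) ?sub1set // cards1.
by rewrite (_ : _ :&: _ = set0) ?cards0 //; apply/eqP; rewrite setI_eq0 disjoint_sym disjoints1.
Qed.

(** Applied to singletons, the cut condition leaves only the inner degrees 2 and 3, and each vertex
    of degree 2 accounts for one boundary edge. Two of these vertices are put into [Ch], so that
    only the others can be missed. *)
Lemma block_covered X : 2 <= #|X| ->
  (forall A, A \proper X -> A != set0 -> 2 <= #|cut (@ends G) (inner X) A|) ->
  boundary X <= #|X| /\ covered_but X (boundary X - 2).
Proof.
move=> X2 conn.
have degX : {in X, forall v, deg (@ends G) (inner X) v = 2 \/ deg (@ends G) (inner X) v = 3}.
  move=> v vX.
  have le3 : deg (@ends G) (inner X) v <= 3.
    rewrite -(deg_cubic v); apply: subset_leq_card; apply/subsetP => e.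
    by rewrite !inE => /andP[_].
  have : 2 <= deg (@ends G) (inner X) v.
    have pv : [set v] \proper X.
      by rewrite properEcard sub1set vX cards1.
    have v0 : [set v] != set0 by rewrite -cards_eq0 cards1.
    apply: leq_trans (conn _ pv v0) _; apply: subset_leq_card; apply/subsetP => e.
    rewrite !inE => /andP[-> /cards1P[w wE]] /=.
    have : w \in ends e :&: [set v] by rewrite wE set11.
    by rewrite !inE => /andP[we /eqP <-].
  by move: le3; case: (deg _ _ _) => [|[|[|[]]]] // _ _; [left|right].
pose D2 := [set v in X | deg (@ends G) (inner X) v == 2].
have cD2 : #|D2| = boundary X.
  have : \sum_(v in X) (deg (@ends G) (inner X) v + (v \in D2)) = 3 * #|X|.
    rewrite mulnC -sum_nat_const; apply: eq_bigr => v vX; rewrite inE vX.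
    by case: (degX v vX) => ->.
  rewrite big_split /= sum_deg_inner cubic_handshake.
  have -> : \sum_(v in X) (v \in D2) = #|D2|.
    rewrite -sum1dep_card big_mkcondr; apply: eq_bigr => v vX.
    by rewrite !inE vX; case: (_ == _).
  by move=> /eqP; rewrite addnC eqn_add2r => /eqP.
split; first by rewrite -cD2; apply/subset_leq_card/subsetP => v; rewrite inE => /andP[].
(* If there are fewer than two such vertices, all are taken, in agreement with the truncated
   difference [boundary X - 2]. *)
have [Ch ChD cCh] := @subset_of_card _ D2 (minn 2 (boundary X)) ltac:(by rewrite cD2 geq_minr).
have [||||||||C CX HC] := @cycle_cover #|X| _ _ (@ends G) X Ch (inner X) => //.
- by move=> e _; apply: card_ends.
- by move=> e; rewrite inE.
- by apply: subset_trans ChD _; apply/subsetP => v; rewrite inE => /andP[].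
- by rewrite cCh geq_minl.
- by move=> v /(subsetP ChD); rewrite inE => /andP[_ /eqP].
- by apply/subset_leq_card/subsetP => v; rewrite !inE => /andP[/andP[_]].
exists C; split=> // [v /HC[|[]]|]; [by right|by left|].
have -> : boundary X - 2 = #|D2 :\: Ch|.
  by rewrite cardsD (setIidPr ChD) cCh cD2; lia.
apply/subset_leq_card/subsetP => v; rewrite !inE => /andP[vX /eqP C0].
by case: (HC v vX); rewrite C0 // => -[_ -> ->]; rewrite vX.
Qed.

(* 2k counts the two ends of a bridge, each of which has at least k vertices behind it:
   splitting along a bridge raises the total boundary by 2. *)
Lemma covered_bound k : 0 < k -> (forall X, boundary X = 1 -> k <= #|X|) ->
  forall X, X != set0 -> exists2 u, covered_but X u &
    if boundary X == 0 then k.+1 * u < #|X| else k.+1 * u + 2 * k <= #|X| + k * boundary X.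
Proof.
move=> k0 hk X; have [n] := ubnP #|X|; elim: n X => // n IH X ltXn X0.
have [/existsP[A /and3P[pA A0 cA]]|noA] := boolP [exists A : {set vert G},
    [&& A \proper X, A != set0 & #|cut (@ends G) (inner X) A| <= 1]].
  have AX := proper_sub pA.
  have cX : #|X| = #|A| + #|X :\: A|.
    by rewrite -(cardsID A X) (setIidPr AX).
  have B0 : X :\: A != set0 by rewrite -subset0 subDset setU0; case/andP: pA.
  have cA0 : 0 < #|A| by rewrite card_gt0.
  have cB0 : 0 < #|X :\: A| by rewrite card_gt0.
  have ltA : #|A| < n by lia.
  have ltB : #|X :\: A| < n by lia.
  have [a covA bA] := IH A ltA A0; have [b covB bB] := IH (X :\: A) ltB B0.
  exists (a + b).
    rewrite (_ : X = A :|: (X :\: A)); last by rewrite -{1}(setID X A) (setIidPr AX).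
    apply: covered_butU covA covB.
    by rewrite -setI_eq0 setDE setICA setICr setI0.
  have := boundary_split AX; have := cut_inner_boundary X A.
  have := cut_inner_boundary X (X :\: A); rewrite (cut_setD AX).
  move: bA bB cA cX cA0 cB0; clear -k0.
  move: #|cut _ _ _| #|A| #|X :\: A| #|X| (boundary A) (boundary (X :\: A)) (boundary X).
  move=> c nA nB nX dA dB dX; clear -k0 => bA bB c1 -> nA0 nB0 c2 c3 c4.
  (* Without a crossing edge the boundaries add up. With one, both sides have positive boundary, and
     the two terms [2 * k] pay for its two ends and leave [2 * k] over. *)
  case: c c1 c2 c3 c4 => [|[|//]] _ c2 c3 c4.
    have {c4} -> : dX = dA + dB by lia.
    rewrite mulnDr; have [dA0|dA0] := eqVneq dA 0; have [dB0|dB0] := eqVneq dB 0.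
    - by rewrite dA0 dB0 /= in bA bB *; lia.
    - by rewrite dA0 add0n (negPf dB0) /= in bA bB *; lia.
    - by rewrite dB0 addn0 (negPf dA0) /= in bA bB *; lia.
    - rewrite addn_eq0 (negPf dA0) (negPf dB0) /= in bA bB *; rewrite mulnDr; lia.
  have [dA0 dB0] : dA != 0 /\ dB != 0 by lia.
  rewrite (negPf dA0) (negPf dB0) in bA bB.
  have kd : k * dA + k * dB = k * dX + 2 * k by rewrite -mulnDr c4 mulnDr; lia.
  rewrite mulnDr; case: eqP => [d0|_]; last lia.
  by move: kd; rewrite d0 muln0; lia.
have conn A : A \proper X -> A != set0 -> 2 <= #|cut (@ends G) (inner X) A|.
  move=> pA A0; rewrite ltnNge; apply: contra noA => c1.
  by apply/existsP; exists A; rewrite pA A0.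
have [X1|X1] := eqVneq #|X| 1.
  have /cards1P[v vE] : #|X| == 1 by rewrite X1.
  (* A single vertex is missed and has boundary 3, which gives equality. *)
  exists 1; last by rewrite vE boundary1 cards1 /=; lia.
  exists set0; split; first exact: sub0set.
    by move=> w _; left; apply: deg0 => e; rewrite inE.
  by rewrite -X1; apply/subset_leq_card/subsetP => w; rewrite inE => /andP[].
have X2 : 2 <= #|X| by move: X0; rewrite -card_gt0; move: X1; case: #|X| => [|[]].
have [dX cov] := block_covered X2 conn.
(* For a boundary [d] of at least 2 the claim reduces to [d - 2 <= #|X|]; for [d = 1] it is
   [k <= #|X|], and for [d = 0] it is that [X] is nonempty. *)
exists (boundary X - 2) => //; have := hk X.
case: eqP => [->|]; first by rewrite sub0n muln0; lia.
move: dX; case: (boundary X) => [|[|d]] dX // _ hX.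
  by rewrite muln0 muln1; have := hX erefl; lia.
by rewrite !subSS subn0 mulSn !mulnS; lia.
Qed.

(** The handshake identity makes [#|X|] odd, and a single vertex has boundary 3. *)
Lemma boundary1_card_ge3 X : boundary X = 1 -> 3 <= #|X|.
Proof.
move=> d1; have := cubic_handshake X; rewrite d1.
have : #|X| != 1 by apply/negP => /cards1P[v vE]; move: d1; rewrite vE boundary1.
case: #|X| => [|[|[|//]]]; lia.
Qed.

(** Three vertices would span four inner edges, but there are only three pairs. *)
Lemma boundary1_card_ge5 X : simple_graph G -> boundary X = 1 -> 5 <= #|X|.
Proof.
move=> sG d1; have X3 := boundary1_card_ge3 d1; have := cubic_handshake X; rewrite d1.
have [X3E|] := eqVneq #|X| 3; last by lia.
suff : #|inner X| <= 3 by lia.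
rewrite -(card_imset _ sG); apply: (@leq_trans #|[set A : {set vert G} | A \subset X & #|A| == 2]|).
  apply/subset_leq_card/subsetP => _ /imsetP[e + ->].
  by rewrite !inE card_ends eqxx andbT.
by rewrite cards_draws X3E.
Qed.

(** The complement of the cycles has one edge at each covered vertex. A missed vertex is expanded,
    and its three edges match the three corners of the triangle. *)
Lemma covered_has_pm u : covered_but setT u ->
  exists2 U : {set vert G}, #|U| <= u & has_pm (expand U).
Proof.
move=> [C [_ HC cU]]; set U := [set v in _ | _] in cU; exists U => //.
have inU v : (v \in U) = (deg (@ends G) C v == 0) by rewrite !inE.
pose M : {set edge (expand U)} := [set x | if x is inl e then e \notin C else false].
apply/existsP; exists M; apply/forallP => -[[v vU]|[[v e] /= ve]]; apply/eqP.
  have : deg (@ends G) (~: C) v = 1.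
    have [|d2] := HC v (in_setT v); first by move/eqP; rewrite -inU (negPf vU).
    by rewrite -setTD degD ?subsetT // deg_cubic d2.
  move=> <-; rewrite card_sum_set [X in _ + X](_ : _ = 0) ?addn0.
    by apply: eq_card => e; rewrite !inE.
  by apply/eqP; rewrite cards_eq0; apply/eqP/setP => q; rewrite !inE.
case/andP: (ve) => /= vU es.
apply/eqP/cards1P; exists (inl e); apply/setP => -[g|q]; rewrite !inE //=.
rewrite (inj_eq inl_inj) [e == g]eq_sym; case: eqP => [->|]; last by rewrite !andbF.
rewrite inE in es; rewrite es !andbT; apply/negP => eC; move: vU; rewrite inU.
by rewrite cards_eq0 => /eqP/setP/(_ e); rewrite !inE eC es.
Qed.

Lemma tnum_bound k : 0 < k -> 0 < #|vert G| -> (forall X, boundary X = 1 -> k <= #|X|) ->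
  k.+1 * tnum G < #|vert G|.
Proof.
move=> k0 V0 hk.
have T0 : [set: vert G] != set0 by rewrite -card_gt0 cardsT.
have [u cov] := covered_bound k0 hk T0.
have -> : boundary setT = 0.
  by apply/eqP; rewrite cards_eq0; apply/eqP/setP => e; rewrite !inE setIT card_ends.
rewrite eqxx cardsT; apply: leq_ltn_trans; rewrite leq_mul2l /=.
have [U cU pmU] := covered_has_pm cov.
by have [_ /(_ U pmU)] := tnumP G; move/leq_trans; apply.
Qed.

End CycleCovers.

(** * Lower bounds: odd subgraphs and linking by bridges *)

(** [F] consists of the old edges of the matching. At an expanded vertex, matched triangle edges
    absorb an even number of the three corners, so an odd number is left to [F]. *)
Lemma has_pm_expand_odd (G : mgraph) (U : {set vert G}) : cubic G -> has_pm (expand U) ->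
  exists2 F : {set edge G}, (forall v, odd #|F :&: star v|) &
    (forall v, v \notin U -> #|F :&: star v| = 1).
Proof.
move=> cG /existsP[M /forallP pmM]; pose F := [set e | inl e \in M].
have F1 v : v \notin U -> #|F :&: star v| = 1.
  move=> vU; have /eqP := pmM (inl (Sub v vU)).
  rewrite card_sum_set [X in _ + X](_ : _ = 0) ?addn0 => [<-|].
    by apply: eq_card => e; rewrite !inE.
  by apply/eqP; rewrite cards_eq0; apply/eqP/setP => q; rewrite !inE /= andbF.
exists F => // v; have [vU|/F1 -> //] := boolP (v \in U).
pose N := [set q : new_edge U | (inr q \in M) && ((val q).1 == v)].
have H e : e \in star v -> (e \in F) + \sum_(q in N) (e \in (val q).2) = 1.
  move=> es; have ok : ((v, e).1 \in U) && ((v, e).2 \in star (v, e).1) by rewrite /= vU es.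
  have /eqP := pmM (inr (Sub (v, e) ok)); rewrite card_sum_set => h1; rewrite -[RHS]h1; congr (_ + _).
    have [eF|eF] := boolP (e \in F).
      rewrite [LHS]/= -[LHS](cards1 e); apply: eq_card => g; rewrite !inE /=.
      rewrite inE in es; rewrite inE in eF.
      have [->|ge] := eqVneq g e; first by rewrite eF es.
      by rewrite !andbF.
    apply/esym/eqP; rewrite cards_eq0; apply/eqP/setP => g; rewrite !inE /=.
    rewrite inE in eF.
    have [->|ge] := eqVneq g e; first by rewrite (negPf eF).
    by rewrite !andbF.
  rewrite -sum1dep_card [RHS]big_mkcond [LHS]big_mkcond /=; apply: eq_bigr => q _.
  rewrite !inE [v == _]eq_sym; case: (_ \in M) => //=.
  by case: (_ == _) => //=; case: (_ \in _).
(* Summing over the corners gives [3 = #|F :&: star v| + 2 * #|N|], as a triangle edge has two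
   ends. *)
have : \sum_(e in star v) ((e \in F) + \sum_(q in N) (e \in (val q).2)) = 3.
  by rewrite (eq_bigr (fun=> 1)) // sum1_card cG.
rewrite big_split /= [X in _ + X]exchange_big /= [X in _ + X](eq_bigr (fun=> 2)) => [|q qN].
  have -> : \sum_(e in star v) (e \in F) = #|F :&: star v|.
    rewrite -sum1_card [LHS]big_mkcond [RHS]big_mkcond; apply: eq_bigr => e _.
    by rewrite !inE; case: (_ \in M); case: (_ \in ends _).
  by rewrite sum_nat_const => /(congr1 odd); rewrite oddD oddM andbF addbF => ->.
have /and3P[_ sq /eqP c2] := valP q; move: qN; rewrite inE => /andP[_ /eqP qv].
rewrite -[RHS]c2 -sum1_card [LHS]big_mkcond [RHS]big_mkcond; apply: eq_bigr => e _.
case: (boolP (e \in (val q).2)) => [/(subsetP sq)|_]; first by rewrite qv => ->.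
by case: (_ \in _).
Qed.

Lemma card_option_sum (A B : finType) (S : {set option (A + B)}) : #|S| =
  (None \in S) + (#|[set a | Some (inl a) \in S]| + #|[set b | Some (inr b) \in S]|).
Proof.
rewrite (cardsD1 None); congr (_ + _).
have -> : S :\ None = Some @: [set x | Some x \in S].
  apply/setP => -[x|]; rewrite !inE ?(mem_imset _ _ Some_inj) ?inE //.
  by apply/esym/negP => /imsetP[].
rewrite card_imset; last exact: Some_inj.
by rewrite card_sum_set; congr (_ + _); apply: eq_card => x; rewrite !inE.
Qed.

(** The root is the vertex to which linking attaches a new edge. *)
Record rooted_graph := RootedGraph { rg :> mgraph; root : vert rg }.

Definition saturated (G : mgraph) (F : {set edge G}) := [set v | star v \subset F].

(* In a cubic graph the saturated vertices of an odd subgraph are those of degree 3,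
   which are the vertices that have to be expanded. *)
Definition forces (G : rooted_graph) m := forall F : {set edge G},
  (forall v, v != root G -> odd #|F :&: star v|) -> m <= #|saturated F|.

Definition cubic_but_root (G : rooted_graph) := forall v : vert G, #|star v| + (v == root G) = 3.

Lemma deg_star (G : mgraph) (F : {set edge G}) v : deg (@ends G) F v = #|F :&: star v|.
Proof. by apply: eq_card => e; rewrite !inE. Qed.

(** The degrees in [F] have an even sum, and the other vertices, even in number, contribute an even
    part of it. *)
Lemma odd_root (G : rooted_graph) (F : {set edge G}) : odd #|vert G| ->
  (forall v, v != root G -> odd #|F :&: star v|) -> ~~ odd #|F :&: star (root G)|.
Proof.
move=> oV oF.
have := @handshake _ _ (@ends G) F setT (fun e _ => card_ends e).
have -> : cut (@ends G) F setT = set0.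
  by apply/setP => e; rewrite !inE setIT card_ends andbF.
rewrite cards0 add0n (bigD1 (root G)) ?inE //= => /(congr1 odd).
rewrite odd_double oddD deg_star.
suff -> : odd (\sum_(v in setT | v != root G) deg (@ends G) F v) = ~~ odd #|vert G|.
  by rewrite oV addbF => ->.
transitivity (odd (\sum_(v in [set: vert G] | v != root G) 1)).
  apply: (big_ind2 (fun a b => odd a = odd b)) => // [a b c d ab cd|v /andP[_ vr]].
    by rewrite !oddD ab cd.
  by rewrite deg_star oF.
rewrite -cardsT -[in RHS]sum1_card [in RHS](bigD1 (root G)) ?inE //=.
by rewrite negbK.
Qed.

Section Link.
Variables (G1 G2 : rooted_graph).

Definition link_ends (x : option (edge G1 + edge G2)) : {set vert G1 + vert G2} :=
  match x with
  | None => [set inl (root G1); inr (root G2)]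
  | Some (inl e) => inl @: ends e
  | Some (inr e) => inr @: ends e
  end.

Lemma card_link_ends x : #|link_ends x| = 2.
Proof.
case: x => [[e|e]|] /=; last by rewrite cards2.
  by rewrite card_imset ?card_ends //; apply: inl_inj.
by rewrite card_imset ?card_ends //; apply: inr_inj.
Qed.

Definition link : rooted_graph := @RootedGraph (MGraph card_link_ends) (inl (root G1)).

Lemma link_starl v : star (inl v : vert link) =
  [set x | match x with
   | None => v == root G1 | Some (inl e) => v \in ends e | Some (inr _) => false end].
Proof.
apply/setP => -[[e|e]|]; rewrite !inE /=.
- by rewrite (mem_imset _ _ inl_inj).
- by apply/negP => /imsetP[].
by rewrite orbF (inj_eq inl_inj).
Qed.

Lemma link_starr v : star (inr v : vert link) =
  [set x | match x with
   | None => v == root G2 | Some (inr e) => v \in ends e | Some (inl _) => false end].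
Proof.
apply/setP => -[[e|e]|]; rewrite !inE /=.
- by apply/negP => /imsetP[].
- by rewrite (mem_imset _ _ inr_inj).
by rewrite (inj_eq inr_inj).
Qed.

Lemma card_link_starl (F : {set edge link}) (v : vert G1) :
  #|F :&: star (inl v : vert link)| =
  ((None \in F) && (v == root G1)) + #|[set e | Some (inl e) \in F] :&: star v|.
Proof.
rewrite link_starl card_option_sum !inE; congr (_ + _).
rewrite [X in _ + X](_ : _ = 0) ?addn0; first by apply: eq_card => e; rewrite !inE.
by apply/eqP; rewrite cards_eq0; apply/eqP/setP => e; rewrite !inE andbF.
Qed.

Lemma card_link_starr (F : {set edge link}) (v : vert G2) :
  #|F :&: star (inr v : vert link)| =
  ((None \in F) && (v == root G2)) + #|[set e | Some (inr e) \in F] :&: star v|.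
Proof.
rewrite link_starr card_option_sum !inE; congr (_ + _).
rewrite [X in X + _](_ : _ = 0) ?add0n; first by apply: eq_card => e; rewrite !inE.
by apply/eqP; rewrite cards_eq0; apply/eqP/setP => e; rewrite !inE andbF.
Qed.

Lemma deg_linkl v : #|star (inl v : vert link)| = #|star v| + (v == root G1).
Proof.
rewrite -[star (inl v : vert link)]setTI card_link_starl inE addnC; congr (_ + _).
by apply: eq_card => e; rewrite !inE.
Qed.

Lemma deg_linkr v : #|star (inr v : vert link)| = #|star v| + (v == root G2).
Proof.
rewrite -[star (inr v : vert link)]setTI card_link_starr inE addnC; congr (_ + _).
by apply: eq_card => e; rewrite !inE.
Qed.

Lemma card_link : #|vert link| = #|vert G1| + #|vert G2|.
Proof. exact: card_sum. Qed.

Lemma link_simple : simple_graph G1 -> simple_graph G2 -> simple_graph link.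
Proof.
move=> s1 s2.
have ne (e : edge G1) (e' : edge G2) : @inl (vert G1) (vert G2) @: ends e <> @inr (vert G1) (vert G2) @: ends e'.
  have /card_gt0P[v ve] : 0 < #|ends e| by rewrite card_ends.
  by move/setP/(_ (inl v)); rewrite (mem_imset _ _ inl_inj) ve => /esym/imsetP[].
have nl (e : edge G1) : @inl (vert G1) (vert G2) @: ends e <> [set inl (root G1); inr (root G2)].
  by move/setP/(_ (inr (root G2))); rewrite !inE eqxx orbT => /imsetP[].
have nr (e : edge G2) : @inr (vert G1) (vert G2) @: ends e <> [set inl (root G1); inr (root G2)].
  by move/setP/(_ (inl (root G1))); rewrite !inE eqxx => /imsetP[].
move=> [[e|e]|] [[f|f]|] //=.
- by move/(imset_inj inl_inj)/s1 => ->.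
- by move/ne.
- by move/nl.
- by move/esym/ne.
- by move/(imset_inj inr_inj)/s2 => ->.
- by move/nr.
- by move/esym/nl.
- by move/esym/nr.
Qed.

(* By parity the second component, having an odd number of vertices, uses the linking edge. *)
Lemma link_forces m1 m2 : odd #|vert G2| -> forces G1 m1 -> forces G2 m2 ->
  forces link (m1 + m2).
Proof.
move=> o2 f1 f2 F oF.
pose F1 := [set e | Some (inl e) \in F]; pose F2 := [set e | Some (inr e) \in F].
have oF1 v : v != root G1 -> odd #|F1 :&: star v|.
  move=> vr; have := oF (inl v); rewrite (inj_eq inl_inj) => /(_ vr).
  by rewrite card_link_starl (negPf vr) andbF.
have oF2 v : v != root G2 -> odd #|F2 :&: star v|.
  move=> vr; have := oF (inr v) isT.
  by rewrite card_link_starr (negPf vr) andbF.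
have NF : None \in F.
  have := oF (inr (root G2)) isT; rewrite card_link_starr eqxx andbT oddD.
  by rewrite (negPf (odd_root o2 oF2)) addbF; case: (_ \in _).
apply: leq_trans (leq_add (f1 _ oF1) (f2 _ oF2)) _.
rewrite [X in _ <= X]card_sum_set; apply: leq_add.
  apply/subset_leq_card/subsetP => v; rewrite 3!in_set link_starl => /subsetP H.
  apply/subsetP => -[[e|e]|]; rewrite inE // => ve.
  by have := H e; rewrite !inE; apply.
apply/subset_leq_card/subsetP => v; rewrite 3!in_set link_starr => /subsetP H.
apply/subsetP => -[[e|e]|]; rewrite inE // => ve.
by have := H e; rewrite !inE; apply.
Qed.

Lemma cubic_link : cubic_but_root G1 -> cubic_but_root G2 -> cubic link.
Proof.
by move=> c1 c2 [v|v]; rewrite ?deg_linkl ?deg_linkr; [apply: c1|apply: c2].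
Qed.

End Link.

(** * Caterpillars *)

Lemma card_no_ends (e : void) : #|(fun _ => set0 : {set unit}) e| = 2.
Proof. by case: e. Qed.

Definition single_vertex : rooted_graph := @RootedGraph (MGraph card_no_ends) tt.

(** The empty star lies in every [F]. Saturation survives linking to odd components, since the
    linking edges then belong to [F]. *)
Lemma forces_single_vertex : forces single_vertex 1.
Proof.
by move=> F _; apply/card_gt0P; exists tt; rewrite inE; apply/subsetP; case.
Qed.

Lemma deg_single_vertex v : #|star (v : vert single_vertex)| = 0.
Proof. by apply/eqP; rewrite cards_eq0; apply/eqP/setP; case. Qed.

(** Each step adds a spine vertex, the new root, joined to the previous root and to a new copy of
    [Q]. The initial copy ends the spine on one side, and [closed_caterpillar] adds one on the
    other: [n + 2] copies in all. *)
Fixpoint caterpillar (Q : rooted_graph) n : rooted_graph :=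
  if n is n'.+1 then link (link single_vertex (caterpillar Q n')) Q else Q.

Definition closed_caterpillar Q n : mgraph := link (caterpillar Q n) Q.

Section Caterpillar.
Variable Q : rooted_graph.
Hypotheses (oddQ : odd #|vert Q|) (cubicQ : cubic_but_root Q).

Lemma caterpillarS n :
  caterpillar Q n.+1 = link (link single_vertex (caterpillar Q n)) Q.
Proof. by []. Qed.

Lemma card_caterpillar n : #|vert (caterpillar Q n)| = n + n.+1 * #|vert Q|.
Proof.
elim: n => [|n IH]; first by rewrite add0n mul1n.
have card1 : #|vert single_vertex| = 1 := card_unit.
by rewrite caterpillarS !card_link IH card1 [n.+2 * _]mulSnr !addnA.
Qed.

Lemma odd_caterpillar n : odd #|vert (caterpillar Q n)|.
Proof. by rewrite card_caterpillar oddD oddM oddQ andbT /=; case: (odd n). Qed.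

Lemma cubic_but_root_caterpillar n : cubic_but_root (caterpillar Q n).
Proof.
elim: n => [|n IH] //= [[[]|v]|v].
- by rewrite !deg_linkl deg_single_vertex eqxx.
- by rewrite deg_linkl deg_linkr !(inj_eq inl_inj) /= !addn0; apply: IH.
- by rewrite deg_linkr /= addn0; apply: cubicQ.
Qed.

Lemma simple_caterpillar n : simple_graph Q -> simple_graph (caterpillar Q n).
Proof.
move=> sQ; elim: n => [//|n IH]; rewrite caterpillarS; apply: link_simple => //.
by apply: link_simple => //; case.
Qed.

Lemma forces_caterpillar n : forces (caterpillar Q n) n.
Proof.
elim: n => [//|n IH]; rewrite caterpillarS -[n.+1]addn0 -add1n.
apply: link_forces => //; apply: link_forces => //; first exact: odd_caterpillar.
exact: forces_single_vertex.
Qed.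

Lemma closed_caterpillar_cubic n : cubic (closed_caterpillar Q n).
Proof. by apply: cubic_link => //; apply: cubic_but_root_caterpillar. Qed.

Lemma closed_caterpillar_simple n : simple_graph Q -> simple_graph (closed_caterpillar Q n).
Proof. by move=> sQ; apply: link_simple => //; apply: simple_caterpillar. Qed.

Lemma card_closed_caterpillar n :
  #|vert (closed_caterpillar Q n)| = n + n.+2 * #|vert Q|.
Proof. by rewrite card_link card_caterpillar -addnA -mulSnr. Qed.

(** A saturated vertex has three edges of [F], whereas a vertex outside [U] has only one. *)
Lemma tnum_closed_caterpillar n : n <= tnum (closed_caterpillar Q n).
Proof.
have [[U pmU <-] _] := tnumP (closed_caterpillar Q n).
have cG := @closed_caterpillar_cubic n.
have [F oF F1] := has_pm_expand_odd cG pmU.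
have fG : forces (link (caterpillar Q n) Q) (n + 0).
  by apply: link_forces => //; apply: forces_caterpillar.
rewrite -[n in n <= _]addn0; apply: leq_trans (fG F (fun v _ => oF v)) _.
apply/subset_leq_card/subsetP => v; rewrite inE => sF; apply: contraT => /F1.
by rewrite (setIidPr sF) cG.
Qed.

End Caterpillar.

(** * Leaf blocks given by edge lists *)

Section ListGraph.
Variables (n : nat) (s : seq (nat * nat)).

(** Edges are positions in the list, so a repeated pair yields parallel edges, and degrees can be
    evaluated with [count]. *)
Definition incident v i := let p := nth (0, 0) s i in (v == p.1) || (v == p.2).

Definition list_ends (i : 'I_(size s)) : {set 'I_n} := [set v : 'I_n | incident v i].

Lemma card_list_ends i :
  all (fun p => [&& p.1 < n, p.2 < n & p.1 != p.2]) s -> #|list_ends i| = 2.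
Proof.
move=> /all_nthP-/(_ (0, 0) i (ltn_ord i)) /and3P[lt1 lt2 ne].
have -> : list_ends i = [set Ordinal lt1; Ordinal lt2] by apply/setP => v; rewrite !inE.
by rewrite cards2 -val_eqE ne.
Qed.

Lemma count_incident v : #|[set i : 'I_(size s) | incident v i]| =
  count (fun p => (v == p.1) || (v == p.2)) s.
Proof.
rewrite -sum1dep_card -sum1_count (big_nth (0, 0)) big_mkord.
by apply: eq_bigl.
Qed.

End ListGraph.

(** A triangle whose edge opposite the root 0 is doubled, of the least size allowed by
    [boundary1_card_ge3]. *)
Definition multi_leaf_edges := [:: (0, 1); (0, 2); (1, 2); (1, 2)].
(** The complete graph on four vertices with one edge subdivided by the root 0, of the least size
    allowed by [boundary1_card_ge5]. *)
Definition simple_leaf_edges := [:: (0, 1); (0, 2); (1, 3); (1, 4); (2, 3); (2, 4); (3, 4)].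

Lemma card_multi_leaf_ends i : #|@list_ends 3 multi_leaf_edges i| = 2.
Proof. exact: card_list_ends. Qed.

Lemma card_simple_leaf_ends i : #|@list_ends 5 simple_leaf_edges i| = 2.
Proof. exact: card_list_ends. Qed.

Definition multi_leaf : rooted_graph := @RootedGraph (MGraph card_multi_leaf_ends) ord0.
Definition simple_leaf : rooted_graph := @RootedGraph (MGraph card_simple_leaf_ends) ord0.

Lemma cubic_but_root_multi_leaf : cubic_but_root multi_leaf.
Proof.
move=> v; rewrite (_ : star v = [set i : 'I_(size multi_leaf_edges) | incident multi_leaf_edges v i]).
  by rewrite count_incident -val_eqE /=; case: v => [[|[|[]]]].
by apply/setP => i; rewrite !inE.
Qed.

Lemma cubic_but_root_simple_leaf : cubic_but_root simple_leaf.
Proof.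
move=> v; rewrite (_ : star v = [set i : 'I_(size simple_leaf_edges) | incident simple_leaf_edges v i]).
  by rewrite count_incident -val_eqE /=; case: v => [[|[|[|[|[]]]]]].
by apply/setP => i; rewrite !inE.
Qed.

Lemma simple_simple_leaf : simple_graph simple_leaf.
Proof.
move=> i j /setP H; apply/val_inj/eqP.
(* By evaluation, any two distinct edges are told apart by some vertex. *)
have : all (fun i => all (fun j => has (fun v =>
    incident simple_leaf_edges v i != incident simple_leaf_edges v j) (iota 0 5)
    || (i == j)) (iota 0 7)) (iota 0 7) by vm_compute.
move=> /allP/(_ (val i)); rewrite mem_iota ltn_ord => /(_ isT).
move=> /allP/(_ (val j)); rewrite mem_iota ltn_ord => /(_ isT) /orP[|//].
move=> /hasP[v]; rewrite mem_iota => /= lt5.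
by have := H (Ordinal lt5); rewrite !inE => ->; rewrite eqxx.
Qed.

(* Limits and the final statement *)
From mathcomp Require Import all_order all_algebra.
From mathcomp Require Import all_classical all_reals all_analysis.
From mathcomp Require Import ring.

Import Order.TTheory GRing.Theory Num.Theory.
Import numFieldNormedType.Exports.
Local Open Scope classical_set_scope.
Local Open Scope ring_scope.

(** The quotient is squeezed between [1 / k - c / (n + 1)] and [1 / k], because [b n] is at most
    [k * a n + c] and at least [n + 1]. *)
Lemma cvg_ratio_affine (R : realType) (k c : nat) (a b : nat -> nat) :
  (0 < k)%N -> (0 < c)%N -> (forall n, b n = k * n + c)%N ->
  (forall n, (n <= a n)%N /\ (k * a n < b n)%N) ->
  ((a n)%:R / (b n)%:R : R) @[n --> \oo] --> (1 / k%:R : R).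
Proof.
move=> k0 c0 bE ha.
have kR : 0 < k%:R :> R by rewrite ltr0n.
have ub : (1 / k%:R : R) @[n --> \oo] --> (1 / k%:R : R) by exact: cvg_cst.
have lb : (1 / k%:R - c%:R * harmonic n : R) @[n --> \oo] --> (1 / k%:R : R).
  rewrite -[X in _ --> X]subr0 -[X in _ --> _ - X](mulr0 (c%:R : R)).
  apply: cvgB; first exact: cvg_cst.
  by apply: cvgMr; exact: cvg_harmonic.
apply: (squeeze_cvgr _ lb ub); near=> n.
have [na kab] := ha n.
have b0 : 0 < (b n)%:R :> R by rewrite ltr0n (leq_ltn_trans _ kab).
have bn : (n.+1)%:R <= (b n)%:R :> R.
  by rewrite ler_nat bE; nia.
have n0 : 0 < (n.+1)%:R :> R by rewrite ltr0n.
apply/andP; split; last first.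
  rewrite ler_pdivrMr // mul1r mulrC ler_pdivlMr //.
  by rewrite -natrM ler_nat mulnC ltnW.
have le1 : (b n)%:R <= k%:R * (a n)%:R + c%:R :> R.
  by rewrite -natrM -natrD ler_nat bE leq_add2r leq_mul2l na orbT.
rewrite lerBlDr -lerBlDl /harmonic /=.
have -> : 1 / k%:R - (a n)%:R / (b n)%:R = ((b n)%:R - k%:R * (a n)%:R) / (k%:R * (b n)%:R) :> R.
  by field; rewrite !gt_eqF.
apply: (@le_trans _ _ (c%:R / (k%:R * (b n)%:R))).
  by rewrite ler_pM2r ?invr_gt0 ?mulr_gt0 // lerBlDl.
rewrite ler_pM2l ?ltr0n // lef_pV2 ?posrE ?mulr_gt0 //.
by apply: le_trans bn _; apply: ler_peMl; [exact: ltW|rewrite ler1n].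
Unshelve. all: by end_near. Qed.

Lemma caterpillar_cvg (R : realType) (Q : rooted_graph) :
  odd #|vert Q| -> cubic_but_root Q ->
  (forall n, #|vert Q|.+1 * tnum (closed_caterpillar Q n) < #|vert (closed_caterpillar Q n)|)%N ->
  #|vert (closed_caterpillar Q n)| @[n --> \oo] --> \oo /\
  ((tnum (closed_caterpillar Q n))%:R / #|vert (closed_caterpillar Q n)|%:R)
    @[n --> \oo] --> (1 / #|vert Q|.+1%:R : R).
Proof.
move=> oQ cQ tb; split.
  apply/cvgnyPge => m; near=> n.
  rewrite card_closed_caterpillar; apply: leq_trans (leq_addr _ _).
  by near: n; exact: nbhs_infty_ge.
(* With [q = #|vert Q|] the number of vertices is [n + (n + 2) * q = (q + 1) * n + 2 * q]. *)
apply: (@cvg_ratio_affine _ #|vert Q|.+1 (2 * #|vert Q|)) => // [|n|n].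
- by move: oQ; case: #|_|.
- rewrite card_closed_caterpillar; nia.
by split=> //; apply: tnum_closed_caterpillar.
Unshelve. all: by end_near. Qed.

Theorem theorem4p4 (R : realType) :
  (forall G : mgraph, (0 < #|vert G|)%N -> cubic G ->
     (tnum G)%:R < #|vert G|%:R / 4 :> R) /\
  (forall G : mgraph, (0 < #|vert G|)%N -> cubic G -> simple_graph G ->
     (tnum G)%:R < #|vert G|%:R / 6 :> R) /\
  (exists G : nat -> mgraph,
     [/\ forall n, (0 < #|vert (G n)|)%N /\ cubic (G n),
         #|vert (G n)| @[n --> \oo] --> \oo &
         (tnum (G n))%:R / #|vert (G n)|%:R @[n --> \oo] --> (1 / 4 : R)]) /\
  (exists G : nat -> mgraph,
     [/\ forall n, [/\ (0 < #|vert (G n)|)%N, cubic (G n) & simple_graph (G n)],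
         #|vert (G n)| @[n --> \oo] --> \oo &
         (tnum (G n))%:R / #|vert (G n)|%:R @[n --> \oo] --> (1 / 6 : R)]).
Proof.
have multi G : (0 < #|vert G|)%N -> cubic G -> (4 * tnum G < #|vert G|)%N.
  by move=> V0 cG; apply: tnum_bound => // X; apply: boundary1_card_ge3.
have simple G : (0 < #|vert G|)%N -> cubic G -> simple_graph G -> (6 * tnum G < #|vert G|)%N.
  by move=> V0 cG sG; apply: tnum_bound => // X; apply: boundary1_card_ge5.
have V0 (Q : rooted_graph) n : odd #|vert Q| -> (0 < #|vert (closed_caterpillar Q n)|)%N.
  by move=> oQ; rewrite card_closed_caterpillar; case: #|vert Q| oQ => // m _; lia.
have c3 : #|vert multi_leaf| = 3%N by apply: card_ord.
have c5 : #|vert simple_leaf| = 5%N by apply: card_ord.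
have o3 : odd #|vert multi_leaf| by rewrite c3.
have o5 : odd #|vert simple_leaf| by rewrite c5.
have cub3 := closed_caterpillar_cubic cubic_but_root_multi_leaf.
have cub5 := closed_caterpillar_cubic cubic_but_root_simple_leaf.
have s5 n := @closed_caterpillar_simple simple_leaf n simple_simple_leaf.
split; [|split; [|split]].
- move=> G G0 cG; rewrite ltr_pdivlMr ?ltr0n // -natrM ltr_nat mulnC.
  exact: multi.
- move=> G G0 cG sG; rewrite ltr_pdivlMr ?ltr0n // -natrM ltr_nat mulnC.
  exact: simple.
- exists (closed_caterpillar multi_leaf).
  have [|cV ct] := @caterpillar_cvg R multi_leaf o3 cubic_but_root_multi_leaf.
    by move=> n; rewrite c3; apply: multi => //; apply: V0.
  by split=> // [n|]; [split=> //; apply: V0|rewrite c3 in ct].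
- exists (closed_caterpillar simple_leaf).
  have [|cV ct] := @caterpillar_cvg R simple_leaf o5 cubic_but_root_simple_leaf.
    by move=> n; rewrite c5; apply: simple => //; apply: V0.
  by split=> // [n|]; [split=> //; apply: V0|rewrite c5 in ct].
Qed.
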